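(* Suppose that $\Gamma$ is a directly finite category of type (FP$_{\mathbb{C}}$). Then $\Gamma$ is of type ($L^2$), and the image of the finiteness obstruction $o(\Gamma;\mathbb{C})$ under the homomorphism $$\mathrm{rk}^{(2)}_\Gamma\colon K_0(\mathbb{C}\Gamma)\to U(\Gamma)\otimes_{\mathbb{Z}}\mathbb{R}=\bigoplus_{\overline{x}\in\mathrm{iso}(\Gamma)}\mathbb{R}$$ is $\chi^{(2)}_f(\Gamma)$.
   Context: All categories are small. $\Gamma$ is directly finite if for all morphisms $u\colon x\to y$, $v\colon y\to x$, $vu=\mathrm{id}_x$ implies $uv=\mathrm{id}_y$. $\mathrm{iso}(\Gamma)$ is the set of isomorphism classes $\overline{x}$ of objects; $U(\Gamma)$ is the free abelian group on it. A $\mathbb{C}\Gamma$-module is a functor $\Gamma^{op}\to\mathbb{C}\text{-Mod}$ (morphisms: natural transformations; exactness objectwise). It is projective iff it is a direct summand of a direct sum of modules $\mathbb{C}\,\mathrm{mor}(?,x)$; finitely generated (f.g.) projective iff the sum can be taken finite. $K_0(\mathbb{C}\Gamma)$ is generated by isomorphism classes of f.g. projective modules modulo short exact sequences. $\Gamma$ is of type (FP$_{\mathbb{C}}$) if the constant module $\underline{\mathbb{C}}$ has a resolution $P_*$ with finitely many nonzero terms, all f.g. projective; then $o(\Gamma;\mathbb{C}):=\sum_n(-1)^n[P_n]$. $\mathbb{C}[x]:=\mathbb{C}[\mathrm{aut}(x)]$. $S_xM$ is the right $\mathbb{C}[x]$-module obtained as the quotient of $M(x)$ by the submodule generated by the images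 of all $M(u)\colon M(y)\to M(x)$ with $u\colon x\to y$ not an isomorphism. $\mathcal{N}(G)$ is the group von Neumann algebra of $G$ (bounded operators on $\ell^2(G)$ commuting with the right $G$-action, containing $\mathbb{C}G$), with trace $\mathrm{tr}(f)=\langle f(e),e\rangle$; $\mathcal{N}(x):=\mathcal{N}(\mathrm{aut}(x))$. $\dim_{\mathcal{N}(G)}(M)\in[0,\infty]$ is L\''uck's dimension: for a f.g. projective right module given by an idempotent matrix $(a_{ij})$ it is $\sum_i\mathrm{tr}(a_{ii})$, and for a general right module it is the supremum over f.g. projective submodules. For an $\mathcal{N}(G)$-chain complex $C_*$, $h^{(2)}(C_* ):=\sum_p\dim_{\mathcal{N}(G)}H_p(C_* )$ and, if finite, $\chi^{(2)}(C_* ):=\sum_p(-1)^p\dim_{\mathcal{N}(G)}H_p(C_* )$. $\Gamma$ is of type ($L^2$) if for some (equivalently every) projective $\mathbb{C}\Gamma$-resolution $P_*$ of $\underline{\mathbb{C}}$, $\sum_{\overline{x}}h^{(2)}(S_xP_*\otimes_{\mathbb{C}[x]}\mathcal{N}(x))<\infty$; then $\chi_f^{(2)}(\Gamma):=(\chi^{(2)}(S_xP_*\otimes_{\mathbb{C}[x]}\mathcal{N}(x)))_{\overline{x}\in\mathrm{iso}(\Gamma)}$, an absolutely summable family of reals. $\mathrm{rk}^{(2)}_\Gamma$ sends $[P]$ to $(\dim_{\mathcal{N}(x)}(S_xP\otimes_{\mathbb{C}[x]}\mathcal{N}(x)))_{\overline{x}}$. *)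

(* Defs.v *)
From HB Require Import structures.
From mathcomp Require Import all_boot all_order all_algebra.
From mathcomp Require Import ring_quotient.
From mathcomp Require Import complex freeg.
From mathcomp Require Import all_classical all_reals ereal topology normedtype.
From mathcomp Require Import sequences esum ring.

Set Implicit Arguments.
Unset Strict Implicit.
Unset Printing Implicit Defensive.

Import Order.TTheory GRing.Theory Num.Theory.
Import numFieldNormedType.Exports.
Local Open Scope classical_set_scope.
Local Open Scope ring_scope.
Local Open Scope quotient_scope.

Section Span.
Context (A : nzRingType) (V : lmodType A) (X : set V).

Inductive spanned : V -> Prop :=
| spanned0 : spanned 0
| spannedD a x v : X x -> spanned v -> spanned (a *: x + v).

Definition spanp : {pred V} := fun v => `[< spanned v >].

Lemma spannedP v : reflect (spanned v) (v \in spanp).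
Proof. exact: asboolP. Qed.

Lemma spanp_submod : submod_closed spanp.
Proof.
split; first exact/spannedP/spanned0.
move=> a u v /spannedP su /spannedP sv; apply/spannedP.
elim: su => [|b x w Xx _ IH]; first by rewrite scaler0 add0r.
rewrite scalerDr scalerA -addrA; exact: spannedD.
Qed.

HB.instance Definition _ := GRing.isSubmodClosed.Build A V spanp spanp_submod.

Lemma spanned_gen x : X x -> spanned x.
Proof. by move=> Xx; rewrite -[x]addr0 -[x]scale1r; exact: spannedD spanned0. Qed.

End Span.

Section Quotmod.
Context (A : nzRingType) (V : lmodType A) (X : set V).

Definition quotmod : Type := @Quotient.quot V (spanp X).
HB.instance Definition _ := GRing.Zmodule.on quotmod.

Definition qpi (v : V) : quotmod := \pi_(Quotient.quot (spanp X)) v.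

Lemma qpiP u v : reflect (qpi u = qpi v) (u - v \in spanp X).
Proof. by rewrite Quotient.idealrBE; exact: eqP. Qed.

Lemma qpi_surj q : exists v, q = qpi v.
Proof. by exists (repr (q : Quotient.quot (spanp X))); rewrite /qpi reprK. Qed.

Lemma qpi_is_zmod_morphism : zmod_morphism qpi.
Proof. move=> u v; exact: (raddfB \pi_(Quotient.quot (spanp X))). Qed.

HB.instance Definition _ := GRing.isZmodMorphism.Build V quotmod qpi qpi_is_zmod_morphism.

Definition qscale (a : A) (q : quotmod) : quotmod :=
  qpi (a *: repr (q : Quotient.quot (spanp X))).

Lemma qscale_pi a v : qscale a (qpi v) = qpi (a *: v).
Proof.
apply/qpiP; rewrite -scalerBr rpredZ//; apply/qpiP.
by rewrite /qpi reprK.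
Qed.

Lemma qscaleA a b q : qscale a (qscale b q) = qscale (a * b) q.
Proof. by have [v ->] := qpi_surj q; rewrite !qscale_pi scalerA. Qed.

Lemma qscale1 : left_id 1 qscale.
Proof. by move=> q; have [v ->] := qpi_surj q; rewrite qscale_pi scale1r. Qed.

Lemma qscaleDr : right_distributive qscale +%R.
Proof.
move=> a q r; have [v ->] := qpi_surj q; have [w ->] := qpi_surj r.
by rewrite -raddfD !qscale_pi scalerDr raddfD.
Qed.

Lemma qscaleDl q : {morph qscale^~ q : a b / a + b}.
Proof.
by move=> a b; have [v ->] := qpi_surj q; rewrite !qscale_pi scalerDl raddfD.
Qed.

HB.instance Definition _ := GRing.Zmodule_isLmodule.Build A quotmod
  qscaleA qscale1 qscaleDr qscaleDl.

Lemma qpi_is_scalable : scalable qpi.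
Proof. by move=> a v; rewrite -qscale_pi. Qed.

HB.instance Definition _ := GRing.isScalable.Build A V quotmod _ qpi qpi_is_scalable.
End Quotmod.

Section QuotMap.
Context (A : nzRingType) (V W : lmodType A) (X : set V) (Y : set W).
Context (f : {linear V -> W}) (fXY : forall x, X x -> Y (f x)).

Lemma spanned_map v : spanned X v -> spanned Y (f v).
Proof.
elim=> [|a x w Xx _ IH]; first by rewrite raddf0; exact: spanned0.
by rewrite linearP; apply: spannedD => //; exact: fXY.
Qed.

Definition quotmap_fun (q : quotmod X) : quotmod Y :=
  qpi Y (f (repr (q : Quotient.quot (spanp X)))).

Lemma quotmap_funE v : quotmap_fun (qpi X v) = qpi Y (f v).
Proof.
apply/qpiP; rewrite -raddfB; apply/spannedP/spanned_map/spannedP/qpiP.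
by rewrite /qpi reprK.
Qed.

Lemma quotmap_is_linear : linear quotmap_fun.
Proof.
move=> a q r; have [v ->] := qpi_surj q; have [w ->] := qpi_surj r.
by rewrite -linearP !quotmap_funE !linearP.
Qed.

Definition quotmap : {linear quotmod X -> quotmod Y} :=
  HB.pack quotmap_fun (GRing.isLinear.Build A (quotmod X) (quotmod Y) _
    quotmap_fun quotmap_is_linear).

Lemma quotmap_pi v : quotmap (qpi X v) = qpi Y (f v).
Proof. exact: quotmap_funE. Qed.
End QuotMap.

Section FreegLinear.
Context (A : nzRingType) (K : choiceType) (V : lmodType A).

HB.instance Definition _ (f : K -> V) :=
  GRing.isZmodMorphism.Build {freeg K / A} V (fglift f) (lift_is_additive f).

Lemma fglift_is_scalable (f : K -> V) : scalable (fglift f).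
Proof.
move=> c D; have -> : fglift f D = \sum_(x <- dom D) coeff x D *: f x.
  rewrite -{1}(freeg_sumE D) raddf_sum.
  by apply: eq_bigr => x _; exact: liftU.
rewrite scaler_sumr [c *: D]/(fgscale c D) /fgscale raddf_sum.
by apply: eq_bigr => x _; rewrite scalerA; exact: liftU.
Qed.

HB.instance Definition _ (f : K -> V) :=
  GRing.isScalable.Build A {freeg K / A} V _ (fglift f) (fglift_is_scalable f).

Lemma freegUZ (c : A) (x : K) : << c *g x >> = c *: << 1 *g x >> :> {freeg K / A}.
Proof. by apply/eqP/freeg_eqP => y; rewrite coeffZ !coeffU mulrA mulr1. Qed.

Lemma freeg_linext (f g : {linear {freeg K / A} -> V}) :
  (forall x, f << 1 *g x >> = g << 1 *g x >>) -> f =1 g.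
Proof.
move=> fg D; rewrite -(freeg_sumE D) !raddf_sum; apply: eq_bigr => x _.
rewrite freegUZ; transitivity (coeff x D *: f << 1 *g x >>).
  exact: linearZ_LR.
by rewrite fg; symmetry; exact: linearZ_LR.
Qed.

End FreegLinear.

Section BaseChange.
Context (A B : nzRingType) (iota : {rmorphism A -> B}).

(* Right modules over a ring are left modules over the converse ring: the    *)
(* right action m a is written a *: m.  The extension of scalars of a right   *)
(* A-module M along iota, M (x)_A B, is the free right B-module on the        *)
(* symbols m (x) 1 modulo (m + m') (x) 1 = m (x) 1 + m' (x) 1 and             *)
(* m a (x) 1 = m (x) iota a; the symbol m (x) b is << b *g m >>.              *)
Inductive tens_rel (M : lmodType A^c) : set {freeg M / B^c} :=
| tens_relD m m' :
    tens_rel (<< 1 *g m + m' >> - (<< 1 *g m >> + << 1 *g m' >>))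
| tens_relZ (a : A^c) m :
    tens_rel (<< 1 *g a *: m >> - << (iota a : B^c) *g m >>).

Definition tens (M : lmodType A^c) : lmodType B^c := quotmod (@tens_rel M).

Definition freeg_map (M N : lmodType A^c) (f : {linear M -> N}) :
    {linear {freeg M / B^c} -> {freeg N / B^c}} :=
  fglift (fun m => << 1 *g f m >> : {freeg N / B^c}).

Lemma freeg_mapU (M N : lmodType A^c) (f : {linear M -> N}) (b : B^c) m :
  freeg_map f << b *g m >> = << b *g f m >>.
Proof. by rewrite [LHS]liftU -freegUZ. Qed.

Lemma tens_rel_map (M N : lmodType A^c) (f : {linear M -> N}) z :
  tens_rel z -> tens_rel (freeg_map f z).
Proof.
case=> [m m'|a m].
  by rewrite linearB linearD !freeg_mapU linearD; exact: tens_relD.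
by rewrite linearB !freeg_mapU linearZ_LR; exact: tens_relZ.
Qed.

Definition tens_map (M N : lmodType A^c) (f : {linear M -> N}) :
    {linear tens M -> tens N} :=
  @quotmap _ _ _ _ _ (freeg_map f) (@tens_rel_map M N f).

Lemma tens_map0 (M N L : lmodType A^c) (f : {linear M -> N}) (g : {linear N -> L}) :
  (forall m, g (f m) = 0) -> forall z, tens_map g (tens_map f z) = 0.
Proof.
move=> gf0 z; have [w ->] := qpi_surj z; rewrite !quotmap_pi.
pose h : {linear {freeg M / B^c} -> tens L} :=
  qpi (@tens_rel L) \o freeg_map g \o freeg_map f.
apply: (freeg_linext (f := h) (g := \0)) => m; rewrite /= !freeg_mapU gf0.
have /spannedP/qpiP := spanned_gen (tens_relD (0 : L) 0).
rewrite addr0 raddfD => /esym/eqP; rewrite -subr_eq0 addrK => /eqP; exact.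
Qed.
End BaseChange.

Section GroupRing.
Context (R : realType) (G : groupType).
Local Notation C := R[i].

Definition gring : Type := {freeg G / C}.
HB.instance Definition _ := GRing.Lmodule.on gring.

Definition gdelta (g : G) : gring := << 1 *g g >>.

Definition gmul (a b : gring) : gring :=
  fglift (fun g => fglift (fun h => gdelta (g * h)%g) b : gring) a.

Lemma gmulDl : left_distributive gmul +%R.
Proof. by move=> a b c; exact: raddfD. Qed.

Lemma gmulZl (k : C) a b : gmul (k *: a) b = k *: gmul a b.
Proof. exact: linearZ_LR. Qed.

Lemma gmul_deltal g b : gmul (gdelta g) b = fglift (fun h => gdelta (g * h)%g) b.
Proof. by rewrite /gmul [LHS]liftU scale1r. Qed.

Lemma gmul_delta g h : gmul (gdelta g) (gdelta h) = gdelta (g * h)%g.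
Proof. by rewrite gmul_deltal [LHS]liftU scale1r. Qed.

Lemma gring_ind (P : gring -> Prop) : P 0 ->
  (forall k g a, P a -> P (k *: gdelta g + a)) -> forall a, P a.
Proof.
move=> P0 PD a; rewrite -[a](freeg_sumE (a : {freeg G / C})).
elim: (dom _) => [|x s IH]; first by rewrite big_nil.
by rewrite big_cons freegUZ; exact: PD.
Qed.

Lemma gmulDr : right_distributive gmul +%R.
Proof.
move=> a b c; elim/gring_ind: a => [|k g a IH]; first by rewrite /gmul !raddf0 ?addr0.
by rewrite !gmulDl IH !gmulZl !gmul_deltal raddfD scalerDr addrACA.
Qed.

Lemma gmulZr (k : C) a b : gmul a (k *: b) = k *: gmul a b.
Proof.
elim/gring_ind: a => [|l g a IH]; first by rewrite /gmul !raddf0.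
rewrite !gmulDl IH !gmulZl !gmul_deltal linearZ_LR scalerDr !scalerA.
by rewrite mulrC.
Qed.

Lemma gmul0 a : gmul 0 a = 0.
Proof. by rewrite /gmul raddf0. Qed.

Lemma gmulr0 a : gmul a 0 = 0.
Proof. by apply: (addrI (gmul a 0)); rewrite -gmulDr !addr0. Qed.

Lemma gmulA : associative gmul.
Proof.
move=> a b c; elim/gring_ind: a => [|k g a IHa]; first by rewrite !gmul0.
rewrite !gmulDl !gmulZl -IHa; congr (_ *: _ + _) => {a IHa}.
elim/gring_ind: b => [|l h b IHb]; first by rewrite !(gmul0, gmulr0).
rewrite gmulDl !gmulDr gmulDl !(gmulZl, gmulZr) IHb; congr (_ *: _ + _) => {b IHb}.
elim/gring_ind: c => [|l' h' c IHc]; first by rewrite !gmulr0.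
by rewrite !gmulDr !gmulZr IHc !gmul_delta mulgA.
Qed.

Lemma gmul1l : left_id (gdelta 1%g) gmul.
Proof.
by elim/gring_ind => [|k g a IH]; rewrite ?gmulr0// gmulDr gmulZr IH gmul_delta mul1g.
Qed.

Lemma gmul1r : right_id (gdelta 1%g) gmul.
Proof.
by elim/gring_ind => [|k g a IH]; rewrite ?gmul0// gmulDl gmulZl IH gmul_delta mulg1.
Qed.

Lemma gdelta1_neq0 : gdelta 1%g != 0.
Proof.
apply/eqP => /(congr1 (fun a : {freeg G / C} => coeff 1%g a))/eqP.
by rewrite raddf0 coeffU eqxx mulr1 oner_eq0.
Qed.

HB.instance Definition _ := GRing.Zmodule_isNzRing.Build gring
  gmulA gmul1l gmul1r gmulDl gmulDr gdelta1_neq0.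

Lemma gring_mulE (a b : gring) : a * b = gmul a b.
Proof. by []. Qed.
End GroupRing.

Section Ell2.
Context (R : realType) (G : groupType).
Local Notation C := R[i].

Definition nsq (z : C) : R := complex.Re z ^+ 2 + complex.Im z ^+ 2.

Lemma nsq_ge0 z : 0 <= nsq z.
Proof. by rewrite addr_ge0// sqr_ge0. Qed.

Lemma nsqM (a z : C) : nsq (a * z) = nsq a * nsq z.
Proof. by case: a z => [a b] [c d]; rewrite /nsq /=; ring. Qed.

Lemma nsqD_le (u v : C) : nsq (u + v) <= 2 * nsq u + 2 * nsq v.
Proof.
case: u v => [a b] [c d]; rewrite /nsq /= -subr_ge0.
have -> : 2 * (a ^+ 2 + b ^+ 2) + 2 * (c ^+ 2 + d ^+ 2) -
  ((a + c) ^+ 2 + (b + d) ^+ 2) = (a - c) ^+ 2 + (b - d) ^+ 2 by ring.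
by rewrite addr_ge0// sqr_ge0.
Qed.

Definition sqnorm (f : G -> C) : \bar R := (\esum_(g in [set: G]) (nsq (f g))%:E)%E.

Lemma sqnorm_ge0 f : (0 <= sqnorm f)%E.
Proof. by apply: esum_ge0 => g _; rewrite lee_fin nsq_ge0. Qed.

Lemma esum_scale_le (K : R) (a : G -> R) : 0 <= K -> (forall g, 0 <= a g) ->
  (\esum_(g in [set: G]) (K * a g)%:E <=
   K%:E * \esum_(g in [set: G]) (a g)%:E)%E.
Proof.
move=> K0 a0; apply: ge_ereal_sup => /= _ [X [finX _] <-].
apply: (@le_trans _ _ (K%:E * \sum_(g \in X) (a g)%:E)%E).
  rewrite ge0_mule_fsumr => [|g]; last by rewrite lee_fin.
  by apply: lee_fsum => // g _; rewrite -EFinM lee_fin.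
rewrite lee_pmul ?lee_fin//; last first.
  by apply: esum_ge; exists X => //; split.
by rewrite fsume_ge0// => g _; rewrite lee_fin.
Qed.

Lemma sqnorm_coef (K : R) (f h : G -> C) : 0 <= K ->
  (forall g, nsq (h g) <= K * nsq (f g)) -> (sqnorm h <= K%:E * sqnorm f)%E.
Proof.
move=> K0 hf; apply: le_trans (esum_scale_le K0 (fun g => nsq_ge0 (f g))).
by apply: le_esum => g _; rewrite lee_fin.
Qed.

Lemma sqnormD (f h : G -> C) :
  (sqnorm (f + h)%R <= 2%:E * sqnorm f + 2%:E * sqnorm h)%E.
Proof.
have nn (k : G -> C) g : [set: G] g -> (0 <= (2 * nsq (k g))%:E)%E.
  by rewrite lee_fin mulr_ge0 ?nsq_ge0.
apply: (@le_trans _ _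
    (\esum_(g in [set: G]) ((2 * nsq (f g))%:E + (2 * nsq (h g))%:E))%E).
  by apply: le_esum => g _; rewrite -EFinD lee_fin nsqD_le.
rewrite esumD; [|exact: nn|exact: nn].
by rewrite leeD// esum_scale_le// => g; exact: nsq_ge0.
Qed.

Lemma sqnorm_bij (e : G -> G) f : bijective e -> sqnorm (f \o e) = sqnorm f.
Proof.
move=> be; rewrite [RHS](@reindex_esum _ _ _ setT setT e)//.
by rewrite setTT_bijective.
Qed.

Definition ell2p : {pred G -> C} := fun f => `[< (sqnorm f < +oo)%E >].

Lemma ell2p_submod : submod_closed ell2p.
Proof.
have coef (K : R) (f h : G -> C) : 0 <= K ->
  (forall g, nsq (h g) <= K * nsq (f g)) -> (sqnorm f < +oo)%E -> (sqnorm h < +oo)%E.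
  move=> K0 hf f_fin; apply: (le_lt_trans (sqnorm_coef K0 hf)).
  by rewrite lte_mul_pinfty.
split.
  apply/asboolP; rewrite /sqnorm esum1// => g _.
  by rewrite /nsq /= expr0n addr0.
move=> a u v /asboolP uf /asboolP vf; apply/asboolP.
apply: (le_lt_trans (sqnormD _ _)); rewrite lte_add_pinfty//; last first.
  by rewrite lte_mul_pinfty.
rewrite lte_mul_pinfty//; apply: (coef (nsq a) u) => //; first exact: nsq_ge0.
by move=> g; rewrite nsqM.
Qed.

HB.instance Definition _ := GRing.isSubmodClosed.Build C (G -> C) ell2p ell2p_submod.

Record ell2 := Ell2 { ell2_fun :> G -> C; ell2P : ell2_fun \in ell2p }.
HB.instance Definition _ := [isSub for ell2_fun].
HB.instance Definition _ := [Choice of ell2 by <:].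
HB.instance Definition _ := [SubChoice_isSubZmodule of ell2 by <:].
HB.instance Definition _ := [SubZmodule_isSubLmodule of ell2 by <:].

Lemma ell2_eqP (f h : ell2) : (forall g, f g = h g) -> f = h.
Proof. by move=> fh; apply/val_inj/funext. Qed.

Lemma ell2_comp_subproof (e : G -> G) (f : ell2) : bijective e -> f \o e \in ell2p.
Proof. by move=> be; apply/asboolP; rewrite sqnorm_bij//; exact/asboolP/ell2P. Qed.

Lemma mulgl_bij (g : G) : bijective (fun h : G => (g * h)%g).
Proof. by exists (fun h => (g^-1 * h)%g) => h; rewrite mulgA ?mulVg ?mulgV mul1g. Qed.

Lemma mulgr_bij (g : G) : bijective (fun h : G => (h * g)%g).
Proof. by exists (fun h => (h * g^-1)%g) => h; rewrite -mulgA ?mulVg ?mulgV mulg1. Qed.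

(* The left and right translations, g delta_h = delta_(g h) and               *)
(* delta_h g = delta_(h g).                                                   *)
Definition ltrans (g : G) (f : ell2) : ell2 :=
  Ell2 (ell2_comp_subproof f (mulgl_bij g^-1%g)).
Definition rtrans (g : G) (f : ell2) : ell2 :=
  Ell2 (ell2_comp_subproof f (mulgr_bij g^-1%g)).

Lemma delta_subproof (g : G) : (fun h => (h == g)%:R : C) \in ell2p.
Proof.
pose a h := (nsq ((h == g)%:R : C))%:E.
have a0 h : (0 <= a h)%E by rewrite lee_fin nsq_ge0.
apply/asboolP; rewrite (_ : sqnorm _ = \esum_(h in [set g]) a h)%E.
  by rewrite esum_set1// ltry.
rewrite esum_mkcond; apply: eq_esum => h _; case: ifPn => //.
rewrite notin_setE/= => /eqP/negPf; rewrite /a => ->.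
by rewrite /nsq /= expr0n addr0.
Qed.

Definition delta (g : G) : ell2 := Ell2 (delta_subproof g).

(* The bounded operators commuting with the right G-action; as usual, a       *)
(* bound K on the squared norms bounds the operator norm by the square root   *)
(* of K.                                                                      *)
Definition vnp : {pred ell2 -> ell2} := fun T => `[<
  [/\ linear T,
      exists2 K : R, 0 <= K & forall f, (sqnorm (T f) <= K%:E * sqnorm f)%E
    & forall g f, T (rtrans g f) = rtrans g (T f)] >].

Lemma vnp_submod : submod_closed vnp.
Proof.
split.
  apply/asboolP; split.
  - by move=> a u v; rewrite [RHS]addr0 [RHS]scaler0.
  - exists 0 => // f; rewrite mul0e [X in (X <= _)%E](_ : _ = 0%E)//.
    by apply: esum1 => g _; rewrite /nsq /= expr0n addr0.
  - by move=> g f; exact: ell2_eqP.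
move=> a T S /asboolP[lT [K K0 bT] eT] /asboolP[lS [L L0 bS] eS].
apply/asboolP; split.
- move=> b u v; rewrite /= !(addrfctE, scalrfctE) lT lS !scalerDr !scalerA.
  by rewrite [a * b]mulrC addrACA.
- exists (2 * (nsq a * K) + 2 * L).
    by rewrite addr_ge0// !mulr_ge0// nsq_ge0.
  move=> f; apply: (le_trans (sqnormD _ _)).
  have f0 := sqnorm_ge0 f.
  rewrite (EFinD (2 * (nsq a * K)) (2 * L)) ge0_muleDl ?lee_fin ?mulr_ge0 ?nsq_ge0// leeD//.
    rewrite EFinM -muleA lee_pmul2l// ?lte_fin//.
    apply: (le_trans (@sqnorm_coef (nsq a) (T f) _ (nsq_ge0 a) _)).
      by move=> g /=; rewrite nsqM.
    by rewrite EFinM -muleA lee_wpmul2l ?lee_fin ?nsq_ge0.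
  by rewrite EFinM -muleA lee_wpmul2l.
- move=> g f; rewrite !(addrfctE, scalrfctE) eT eS; exact: ell2_eqP.
Qed.

HB.instance Definition _ :=
  GRing.isSubmodClosed.Build C (ell2 -> ell2) vnp vnp_submod.

Record vnalg := VN { vn_fun :> ell2 -> ell2; vnP : vn_fun \in vnp }.
HB.instance Definition _ := [isSub for vn_fun].
HB.instance Definition _ := [Choice of vnalg by <:].
HB.instance Definition _ := [SubChoice_isSubZmodule of vnalg by <:].
HB.instance Definition _ := [SubZmodule_isSubLmodule of vnalg by <:].

Lemma vn_eqP (S T : vnalg) : (forall f, S f = T f) -> S = T.
Proof. by move=> ST; apply/val_inj/funext. Qed.

Lemma vn_linear (T : vnalg) : linear T.
Proof. by have /asboolP[] := vnP T. Qed.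

Lemma vn_id_subproof : idfun \in vnp.
Proof. by apply/asboolP; split=> //; exists 1 => // f; rewrite mul1e. Qed.

Lemma vn_comp_subproof (S T : vnalg) : vn_fun S \o vn_fun T \in vnp.
Proof.
have /asboolP[lS [K K0 bS] eS] := vnP S; have /asboolP[lT [L L0 bT] eT] := vnP T.
apply/asboolP; split=> [a u v|| g f] /=; first by rewrite lT lS.
- exists (K * L); first exact: mulr_ge0.
  move=> f; apply: (le_trans (bS _)); rewrite EFinM -muleA lee_wpmul2l//.
- by rewrite eT eS.
Qed.

Definition vn_one : vnalg := VN vn_id_subproof.
Definition vn_mul (S T : vnalg) : vnalg := VN (vn_comp_subproof S T).

Lemma vn_mulA : associative vn_mul.
Proof. by move=> S T U; exact: vn_eqP. Qed.
Lemma vn_mul1l : left_id vn_one vn_mul.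
Proof. by move=> T; exact: vn_eqP. Qed.
Lemma vn_mul1r : right_id vn_one vn_mul.
Proof. by move=> T; exact: vn_eqP. Qed.
Lemma vn_mulDl : left_distributive vn_mul +%R.
Proof. by move=> S T U; exact: vn_eqP. Qed.
Lemma vn_mulDr : right_distributive vn_mul +%R.
Proof.
move=> S T U; apply: vn_eqP => f /=.
by have := vn_linear S 1 (T f) (U f); rewrite !scale1r.
Qed.
Lemma vn_one_neq0 : vn_one != 0.
Proof.
apply/eqP => /(congr1 (fun T : vnalg => T (delta 1%g) 1%g)) /= /eqP.
by rewrite eqxx oner_eq0.
Qed.

HB.instance Definition _ := GRing.Zmodule_isNzRing.Build vnalg
  vn_mulA vn_mul1l vn_mul1r vn_mulDl vn_mulDr vn_one_neq0.

(* <T e, e>, where <f, delta_e> = f e.                                        *)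
Definition vntr (T : vnalg) : C := T (delta 1%g) 1%g.

Lemma ltrans_subproof (g : G) : ltrans g \in vnp.
Proof.
apply/asboolP; split.
- by move=> a u v; exact: ell2_eqP.
- by exists 1 => // f; rewrite mul1e sqnorm_bij//; exact: mulgl_bij.
- by move=> h f; apply: ell2_eqP => k /=; rewrite mulgA.
Qed.

Definition vn_ltrans (g : G) : vnalg := VN (ltrans_subproof g).

Lemma vn_ltransM g h : vn_ltrans g * vn_ltrans h = vn_ltrans (g * h)%g.
Proof.
by apply: vn_eqP => f; apply: ell2_eqP => k /=; rewrite invgM mulgA.
Qed.

Lemma vn_ltrans1 : vn_ltrans 1%g = 1.
Proof.
by apply: vn_eqP => f; apply: ell2_eqP => k /=; rewrite invg1 mul1g.
Qed.

Lemma vn_scalel (a : C) (S T : vnalg) : (a *: S) * T = a *: (S * T).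
Proof. exact: vn_eqP. Qed.

Lemma vn_scaler (a : C) (S T : vnalg) : S * (a *: T) = a *: (S * T).
Proof.
apply: vn_eqP => f /=; have := vn_linear S a (T f) 0.
have S0 : S 0 = 0.
  have := vn_linear S 1 0 0; rewrite !scale1r addr0 => /eqP.
  by rewrite -subr_eq0 opprD addrA subrr add0r oppr_eq0 => /eqP.
by rewrite S0 !addr0.
Qed.

Definition gring_vn : gring R G -> vnalg :=
  fun a => fglift vn_ltrans (a : {freeg G / C}).

Lemma gring_vn_delta g : gring_vn (gdelta R g) = vn_ltrans g.
Proof. by rewrite /gring_vn [LHS]liftU scale1r. Qed.

Lemma gring_vn_is_linear : linear gring_vn.
Proof. move=> a u v; exact: (linearP (fglift vn_ltrans)). Qed.

HB.instance Definition _ :=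
  GRing.isLinear.Build C (gring R G) vnalg _ gring_vn gring_vn_is_linear.

Lemma gring_vn0 : gring_vn 0 = 0.
Proof. exact: raddf0. Qed.

Lemma gring_vn_is_monoid_morphism : monoid_morphism gring_vn.
Proof.
split; first by rewrite -vn_ltrans1 -gring_vn_delta.
move=> a b; rewrite gring_mulE; elim/gring_ind: a => [|k g a IHa].
  by rewrite gmul0 gring_vn0 mul0r.
rewrite gmulDl gmulZl !gring_vn_is_linear IHa gring_vn_delta mulrDl vn_scalel.
congr (_ *: _ + _) => {a IHa}; elim/gring_ind: b => [|l h b IHb].
  by rewrite gmulr0 gring_vn0 mulr0.
rewrite gmulDr gmulZr !gring_vn_is_linear IHb gring_vn_delta mulrDr vn_scaler.
by rewrite gmul_delta gring_vn_delta vn_ltransM.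
Qed.

HB.instance Definition _ := GRing.isMonoidMorphism.Build (gring R G) vnalg
  gring_vn gring_vn_is_monoid_morphism.
End Ell2.

Section Dimension.
Context (R : realType) (G : groupType).
Local Notation N := (vnalg R G).

(* P is a submodule of the right N-module M isomorphic to the f.g. projective *)
(* module b N^n, for b an idempotent n x n matrix over N.  Over the converse   *)
(* ring b N^n is the module of row vectors v with v *m a = v, where a = b^T;   *)
(* a is idempotent over N^c since b is over N, and has the same diagonal.     *)
Definition is_fgproj_sub (M : lmodType N^c) (P : set M) n (a : 'M[N^c]_n) :=
  a *m a = a /\
  exists phi : {linear 'rV[N^c]_n -> M},
    (forall v, v *m a = v -> phi v = 0 -> v = 0) /\
    P = phi @` [set v | v *m a = v].

(* The sum of the diagonal traces of an idempotent matrix is a real number.   *)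
Definition mxdim n (a : 'M[N^c]_n) : R :=
  complex.Re (\sum_(i < n) vntr (a i i : N)).

(* For f.g. projective M the supremum is the value mxdim on any idempotent    *)
(* matrix presenting M itself, so that this covers all right modules.         *)
Definition vndim (M : lmodType N^c) : \bar R :=
  ereal_sup [set d | exists (P : set M) n (a : 'M[N^c]_n),
                       is_fgproj_sub P a /\ d = (mxdim a)%:E].
End Dimension.

Section ChainComplex.
Context (A : nzRingType).

Record chain_complex := ChainComplex {
  ch : nat -> lmodType A;
  bd : forall n, {linear ch n.+1 -> ch n};
  bd_bd : forall n z, bd n (bd n.+1 z) = 0 }.

Definition cyclep (D : chain_complex) n : {pred ch D n} :=
  match n return {pred ch D n} with
  | 0 => fun=> true
  | m.+1 => fun z => bd D m z == 0
  end.

Lemma cyclep_submod (D : chain_complex) n : submod_closed (@cyclep D n).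
Proof.
case: n => [//|n]; split; first by apply/eqP; exact: raddf0.
move=> a u v /eqP du /eqP dv; apply/eqP.
by rewrite linearP du dv scaler0 addr0.
Qed.

HB.instance Definition _ D n :=
  GRing.isSubmodClosed.Build A (ch D n) (@cyclep D n) (@cyclep_submod D n).

Record cycle (D : chain_complex) n :=
  Cycle { cycle_val : ch D n; cycleP : cycle_val \in @cyclep D n }.
HB.instance Definition _ D n := [isSub for @cycle_val D n].
HB.instance Definition _ D n := [Choice of @cycle D n by <:].
HB.instance Definition _ D n := [SubChoice_isSubZmodule of @cycle D n by <:].
HB.instance Definition _ D n := [SubZmodule_isSubLmodule of @cycle D n by <:].

Definition boundary (D : chain_complex) n : set (cycle D n) :=
  [set z | exists c, bd D n c = cycle_val z].

Definition homology (D : chain_complex) n : lmodType A :=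
  quotmod (@boundary D n).
End ChainComplex.

Section L2Euler.
Context (R : realType) (G : groupType).

Definition h2 (D : chain_complex (vnalg R G)^c) : \bar R :=
  (\sum_(0 <= p <oo) vndim (homology D p))%E.

Definition chi2 (D : chain_complex (vnalg R G)^c) : R :=
  lim (series (fun p => (-1) ^+ p * fine (vndim (homology D p))) @ \oo).
End L2Euler.

Record category := Category {
  ob :> Type;
  hom : ob -> ob -> Type;
  idc : forall x, hom x x;
  cmp : forall x y z, hom y z -> hom x y -> hom x z;
  cmp1l : forall x y (u : hom x y), cmp (idc y) u = u;
  cmp1r : forall x y (u : hom x y), cmp u (idc x) = u;
  cmpA : forall w x y z (u : hom y z) (v : hom x y) (t : hom w x),
    cmp u (cmp v t) = cmp (cmp u v) t }.
Arguments idc {c} x.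

Definition directly_finite (Gam : category) :=
  forall (x y : Gam) (u : hom x y) (v : hom y x),
    cmp v u = idc x -> cmp u v = idc y.

Section Category.
Context (Gam : category).

Definition is_iso (x y : Gam) (u : hom x y) :=
  exists v : hom y x, cmp v u = idc x /\ cmp u v = idc y.

Definition isomorphic (x y : {classic Gam}) : bool :=
  `[< exists u : @hom Gam x y, is_iso u >].

Lemma isomorphic_refl : reflexive isomorphic.
Proof. by move=> x; apply/asboolP; exists (idc x), (idc x); rewrite !cmp1l. Qed.

Lemma isomorphic_sym : symmetric isomorphic.
Proof.
by move=> x y; apply/asboolP/asboolP => -[u [v [vu uv]]]; exists v, u.
Qed.

Lemma isomorphic_trans : transitive isomorphic.
Proof.
move=> y x z /asboolP[u [v [vu uv]]] /asboolP[s [t [ts st]]]; apply/asboolP.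
exists (cmp s u), (cmp v t); split.
  by rewrite cmpA -(cmpA v) ts cmp1r.
by rewrite cmpA -(cmpA s) uv cmp1r.
Qed.

Canonical isomorphic_equiv :=
  EquivRel isomorphic isomorphic_refl isomorphic_sym isomorphic_trans.

Definition isocl := {eq_quot isomorphic}.
HB.instance Definition _ := Choice.on isocl.
Definition iso_class (x : Gam) : isocl := \pi_{eq_quot isomorphic} (x : {classic Gam}).

Lemma iso_classP (x y : Gam) :
  iso_class x = iso_class y <-> exists u : hom x y, is_iso u.
Proof.
split=> [/eqquotP /asboolP//|xy]; exact/eqquotP/asboolP.
Qed.

Record aut (x : Gam) := Aut {
  aut_fun : hom x x;
  aut_inv : hom x x;
  aut_invl : cmp aut_inv aut_fun = idc x;
  aut_invr : cmp aut_fun aut_inv = idc x }.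

Lemma aut_eq x (a b : aut x) : aut_fun a = aut_fun b -> a = b.
Proof.
case: a b => [u u' u'u uu'] [v v' v'v vv'] /= uv; subst v.
have uv' : u' = v' by rewrite -[u']cmp1r -vv' cmpA u'u cmp1l.
by subst v'; congr Aut; exact: Prop_irrelevance.
Qed.

HB.instance Definition _ x := gen_eqMixin (aut x).
HB.instance Definition _ x := gen_choiceMixin (aut x).

Definition aut_one x : aut x := Aut (cmp1l (idc x)) (cmp1l (idc x)).

Definition aut_V x (a : aut x) : aut x := Aut (aut_invr a) (aut_invl a).

Lemma aut_mul_subproof x (u u' v v' : @hom Gam x x) :
  cmp u u' = idc x -> cmp v v' = idc x -> cmp (cmp u v) (cmp v' u') = idc x.
Proof. by move=> uu' vv'; rewrite cmpA -(cmpA u) vv' cmp1r. Qed.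

Definition aut_mul x (a b : aut x) : aut x :=
  Aut (aut_mul_subproof (aut_invl b) (aut_invl a))
      (aut_mul_subproof (aut_invr a) (aut_invr b)).

Lemma aut_mulA x : associative (@aut_mul x).
Proof. by move=> a b c; apply: aut_eq; exact: cmpA. Qed.
Lemma aut_mul1l x : left_id (aut_one x) (@aut_mul x).
Proof. by move=> a; apply: aut_eq; exact: cmp1l. Qed.
Lemma aut_mul1r x : right_id (aut_one x) (@aut_mul x).
Proof. by move=> a; apply: aut_eq; exact: cmp1r. Qed.
Lemma aut_mulVl x : left_inverse (aut_one x) (@aut_V x) (@aut_mul x).
Proof. by move=> a; apply: aut_eq; exact: aut_invl. Qed.
Lemma aut_mulVr x : right_inverse (aut_one x) (@aut_V x) (@aut_mul x).
Proof. by move=> a; apply: aut_eq; exact: aut_invr. Qed.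

HB.instance Definition _ x := isGroup.Build (aut x)
  (@aut_mulA x) (@aut_mul1l x) (@aut_mul1r x) (@aut_mulVl x) (@aut_mulVr x).
End Category.

Section Modules.
Context (R : realType) (Gam : category).
Local Notation C := R[i].

Record cmodule := CModule {
  cm :> Gam -> lmodType C;
  act : forall x y : Gam, hom x y -> {linear cm y -> cm x};
  act_id : forall (x : Gam) (m : cm x), act (idc x) m = m;
  act_cmp : forall (x y z : Gam) (u : hom y z) (v : hom x y) (m : cm z),
    act (cmp u v) m = act v (act u m) }.

Record cmap (M N : cmodule) := CMap {
  cmap_fun :> forall x, {linear M x -> N x};
  cmapE : forall (x y : Gam) (u : hom x y) (m : M y),
    cmap_fun x (act M u m) = act N u (cmap_fun y m) }.

Definition cm_isomorphic (M N : cmodule) :=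
  exists f : cmap M N, forall x, bijective (f x).

Definition short_exact (M0 M1 M2 : cmodule) :=
  exists (f : cmap M0 M1) (g : cmap M1 M2),
    forall x, [/\ injective (f x), forall n, exists m, g x m = n
                & forall m, g x m = 0 <-> exists k, f x k = m].

Definition cm_const : cmodule :=
  @CModule (fun=> C^o) (fun x y u => idfun) (fun x m => erefl)
    (fun x y z u v m => erefl).

Section PairMap.
Context (U U' V V' : lmodType C).
Context (f : {linear U -> U'}) (g : {linear V -> V'}).

Definition pair_map : (U * V)%type -> (U' * V')%type := fun p => (f p.1, g p.2).

Lemma pair_map_is_linear : linear pair_map.
Proof. by move=> a [u v] [u' v']; rewrite /pair_map /= !linearP. Qed.

HB.instance Definition _ :=
  GRing.isLinear.Build C (U * V)%type (U' * V')%type _ pair_map pair_map_is_linear.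
End PairMap.

Program Definition cm_sum (M N : cmodule) : cmodule :=
  @CModule (fun x => (M x * N x)%type)
    (fun x y u => pair_map (act M u) (act N u)) _ _.
Next Obligation. by move=> M N x [m n]; congr (_, _); exact: act_id. Qed.
Next Obligation. by move=> M N x y z u v [m n]; congr (_, _); exact: act_cmp. Qed.

(* The direct sum of the modules C mor(?, o i): at y it has basis the         *)
(* disjoint union of the sets mor(y, o i).                                    *)
Section Free.
Context (I : Type) (o : I -> Gam).

Definition free_basis (y : Gam) : Type := {classic {i : I & hom y (o i)}}.
HB.instance Definition _ y := Choice.on (free_basis y).

Definition free_act (x y : Gam) (u : hom x y) (t : free_basis y) : free_basis x :=
  existT (fun i => hom x (o i)) (projT1 t) (cmp (projT2 t) u).

Definition free_lin (x y : Gam) (u : hom x y) :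
    {linear {freeg (free_basis y) / C} -> {freeg (free_basis x) / C}} :=
  fglift (fun t => << 1 *g free_act u t >> : {freeg (free_basis x) / C}).

Lemma free_linU (x y : Gam) (u : hom x y) (t : free_basis y) :
  free_lin u << 1 *g t >> = << 1 *g free_act u t >>.
Proof. by rewrite [LHS]liftU scale1r. Qed.

Lemma free_lin_id x m : free_lin (idc x) m = m.
Proof.
apply: (freeg_linext (f := free_lin (idc x)) (g := idfun)) => -[i h].
by rewrite free_linU /free_act /= cmp1r.
Qed.

Lemma free_lin_cmp x y z (u : hom y z) (v : hom x y) m :
  free_lin (cmp u v) m = free_lin v (free_lin u m).
Proof.
apply: (freeg_linext (f := free_lin (cmp u v)) (g := free_lin v \o free_lin u)).
by case=> i h; rewrite /= !free_linU /free_act /= cmpA.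
Qed.

Definition cm_free : cmodule :=
  @CModule (fun y => {freeg (free_basis y) / C}) free_lin free_lin_id free_lin_cmp.
End Free.

Definition direct_summand (M F : cmodule) :=
  exists N : cmodule, cm_isomorphic (cm_sum M N) F.

Definition projective (M : cmodule) :=
  exists (I : Type) (o : I -> Gam), direct_summand M (cm_free o).

Definition fg_projective (M : cmodule) :=
  exists (n : nat) (o : 'I_n -> Gam), direct_summand M (cm_free o).

Record resolution (M : cmodule) := Resolution {
  res :> nat -> cmodule;
  res_d : forall n, cmap (res n.+1) (res n);
  res_eps : cmap (res 0) M;
  res_surj : forall x m, exists p, res_eps x p = m;
  res_exact0 : forall x p, res_eps x p = 0 <-> exists q, res_d 0 x q = p;
  res_exactS : forall n x p,
    res_d n x p = 0 <-> exists q, res_d n.+1 x q = p }.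

Section Splitting.
Context (x : Gam).
Local Notation Cx := (gring R (aut x)).
Local Notation Nx := (vnalg R (aut x)).

(* M(x) as a right C[x]-module, with m a = M(a) m for a in aut(x).            *)
Definition cm_at (M : cmodule) : Type := M x.
HB.instance Definition _ M := GRing.Zmodule.on (cm_at M).

Definition at_scale (M : cmodule) (a : Cx^c) (m : cm_at M) : cm_at M :=
  fglift (fun g : aut x => act M (aut_fun g) m) (a : {freeg (aut x) / C}).

Lemma at_scale_linear (M : cmodule) (m : cm_at M) (k : C) (a b : Cx) :
  at_scale (k *: a + b) m = (k *: (at_scale a m : M x) : M x) + at_scale b m.
Proof. exact: linearP. Qed.

Lemma at_scale0 (M : cmodule) (m : cm_at M) : at_scale (0 : Cx) m = 0 :> cm_at M.
Proof. exact: raddf0. Qed.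

Lemma at_scale_delta (M : cmodule) (g : aut x) (m : cm_at M) :
  at_scale (gdelta R g) m = act M (aut_fun g) m :> cm_at M.
Proof. by rewrite /at_scale [LHS]liftU scale1r. Qed.

Lemma at_scaleDr (M : cmodule) : right_distributive (@at_scale M) +%R.
Proof.
move=> a m n; elim/gring_ind: a => [|k g a IH]; first by rewrite !at_scale0 addr0.
rewrite !at_scale_linear IH !at_scale_delta.
by rewrite [act M _ _]raddfD scalerDr addrACA.
Qed.

Lemma at_scale_at0 (M : cmodule) (a : Cx) : at_scale a 0 = 0 :> cm_at M.
Proof. by apply: (addrI (at_scale a 0)); rewrite -at_scaleDr !addr0. Qed.

Lemma at_scaleZ (M : cmodule) (a : Cx) (k : C) (m : M x) :
  at_scale a (k *: m : M x) = (k *: (at_scale a m : M x) : M x).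
Proof.
elim/gring_ind: a => [|l g a IH]; first by rewrite !at_scale0 [RHS]scaler0.
rewrite !at_scale_linear IH !at_scale_delta scalerDr !scalerA.
by rewrite [act M _ _]linearZ_LR scalerA mulrC.
Qed.

Lemma at_scale_gmul (M : cmodule) (a b : Cx) (m : cm_at M) :
  at_scale a (at_scale b m) = at_scale (gmul b a) m.
Proof.
elim/gring_ind: b => [|k g b IHb].
  by rewrite at_scale0 at_scale_at0 gmul0 at_scale0.
rewrite gmulDl gmulZl !at_scale_linear at_scaleDr at_scaleZ IHb.
congr (_ *: _ + _) => {b IHb}; rewrite at_scale_delta.
elim/gring_ind: a => [|l h a IHa]; first by rewrite gmulr0 !at_scale0.
rewrite gmulDr gmulZr !at_scale_linear IHa gmul_delta !at_scale_delta.
by rewrite -act_cmp.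
Qed.

Lemma at_scaleA (M : cmodule) (a b : Cx^c) (m : cm_at M) :
  at_scale a (at_scale b m) = at_scale (a * b) m.
Proof. exact: at_scale_gmul. Qed.

Lemma at_scale1 (M : cmodule) : left_id (1 : Cx^c) (@at_scale M).
Proof. by move=> m; rewrite at_scale_delta act_id. Qed.

Lemma at_scaleDl (M : cmodule) (m : cm_at M) : {morph (@at_scale M)^~ m : a b / a + b}.
Proof. move=> a b; exact: raddfD. Qed.

HB.instance Definition _ M := GRing.Zmodule_isLmodule.Build Cx^c (cm_at M)
  (@at_scaleA M) (@at_scale1 M) (@at_scaleDr M) (@at_scaleDl M).

Definition cmap_at (M N : cmodule) (f : cmap M N) : cm_at M -> cm_at N := f x.

Lemma cmap_at_scale (M N : cmodule) (f : cmap M N) (a : Cx) (m : cm_at M) :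
  cmap_at f (at_scale a m) = at_scale a (cmap_at f m).
Proof.
elim/gring_ind: a => [|k g a IH].
  by rewrite !at_scale0 [LHS](raddf0 (f x)).
rewrite !at_scale_linear -IH !at_scale_delta /cmap_at -cmapE.
exact: (linearP (f x)).
Qed.

Lemma cmap_at_is_linear (M N : cmodule) (f : cmap M N) : linear (@cmap_at M N f).
Proof.
move=> a m n; rewrite -[a *: cmap_at f m]cmap_at_scale.
exact: (raddfD (f x)).
Qed.

HB.instance Definition _ M N f :=
  GRing.isLinear.Build Cx^c (cm_at M) (cm_at N) _ (@cmap_at M N f)
    (cmap_at_is_linear f).

Inductive singular (M : cmodule) : set (cm_at M) :=
| Singular (y : Gam) (u : hom x y) (m : M y) :
    ~ is_iso u -> singular (act M u m : cm_at M).

Definition splitting (M : cmodule) : lmodType Cx^c := quotmod (@singular M).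

Lemma singular_map (M N : cmodule) (f : cmap M N) z :
  singular z -> singular (cmap_at f z).
Proof. by case=> y u m nu; rewrite /cmap_at cmapE; exact: Singular. Qed.

Definition splitting_map (M N : cmodule) (f : cmap M N) :
    {linear splitting M -> splitting N} :=
  @quotmap _ _ _ _ _ (cmap_at f) (@singular_map M N f).

(* S_x M (x)_C[x] N(x), with S_x M = splitting M.                             *)
Definition vnsplitting (M : cmodule) : lmodType Nx^c :=
  tens (@gring_vn R (aut x)) (splitting M).

Definition vnsplitting_map (M N : cmodule) (f : cmap M N) :
    {linear vnsplitting M -> vnsplitting N} :=
  tens_map (@gring_vn R (aut x)) (splitting_map f).

Lemma vnsplitting_map0 (M N L : cmodule) (f : cmap M N) (g : cmap N L) :
  (forall m, g x (f x m) = 0) -> forall z, vnsplitting_map g (vnsplitting_map f z) = 0.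
Proof.
move=> gf0; apply: tens_map0 => q; have [m ->] := qpi_surj q.
by rewrite !quotmap_pi /= [X in qpi _ X]gf0 raddf0.
Qed.

Lemma res_dd M (P : resolution M) n m : res_d P n x (res_d P n.+1 x m) = 0.
Proof. by apply/res_exactS; exists m. Qed.

Definition vnsplitting_complex (M : cmodule) (P : resolution M) :
    chain_complex Nx^c :=
  @ChainComplex _ (fun n => vnsplitting (P n)) (fun n => vnsplitting_map (res_d P n))
    (fun n => vnsplitting_map0 (@res_dd M P n)).
End Splitting.
End Modules.

Section K0.
Context (R : realType) (Gam : category).

Record fgproj := FGProj {
  fgproj_mod :> cmodule R Gam;
  fgproj_fg : fg_projective fgproj_mod }.

(* K_0 as the abelian group presented by its generators and relations: a word *)
(* is a formal sum of signed generators, (b, P) standing for [P] if b is true *)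
(* and for - [P] otherwise.                                                   *)
Definition k0word : Type := seq (bool * fgproj).

Inductive k0rel : k0word -> k0word -> Prop :=
| k0rel_refl w : k0rel w w
| k0rel_sym w w' : k0rel w w' -> k0rel w' w
| k0rel_trans w w' w'' : k0rel w w' -> k0rel w' w'' -> k0rel w w''
| k0rel_cat w1 w1' w2 w2' :
    k0rel w1 w1' -> k0rel w2 w2' -> k0rel (w1 ++ w2) (w1' ++ w2')
| k0rel_comm w1 w2 : k0rel (w1 ++ w2) (w2 ++ w1)
| k0rel_opp b (P : fgproj) : k0rel [:: (b, P); (~~ b, P)] [::]
| k0rel_iso (P Q : fgproj) : cm_isomorphic P Q -> k0rel [:: (true, P)] [:: (true, Q)]
| k0rel_exact (P0 P1 P2 : fgproj) : short_exact P0 P1 P2 ->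
    k0rel [:: (true, P1)] [:: (true, P0); (true, P2)].

Definition K0 : Type := {c : k0word -> Prop | exists w, c = k0rel w}.

Definition k0class (w : k0word) : K0 := exist _ (k0rel w) (ex_intro _ w erefl).

Definition k0repr (a : K0) : k0word := projT1 (cid (projT2 a)).

Lemma k0reprK a : k0class (k0repr a) = a.
Proof.
by case: a => c h; apply: eq_exist; rewrite /k0repr; case: (cid _) => w /= ->.
Qed.

Lemma k0classP w w' : k0class w = k0class w' <-> k0rel w w'.
Proof.
split=> [[e]|e]; first by rewrite e; exact: k0rel_refl.
apply: eq_exist; apply/funext => v; apply/propext; split => h.
  exact: k0rel_trans (k0rel_sym e) h.
exact: k0rel_trans e h.
Qed.

Definition k0opp_word (w : k0word) : k0word := [seq (~~ g.1, g.2) | g <- w].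

Definition k0zero : K0 := k0class [::].
Definition k0add (a b : K0) : K0 := k0class (k0repr a ++ k0repr b).
Definition k0opp (a : K0) : K0 := k0class (k0opp_word (k0repr a)).
Definition k0gen (P : fgproj) : K0 := k0class [:: (true, P)].

Lemma k0rel_repr w : k0rel (k0repr (k0class w)) w.
Proof. by apply/k0classP; rewrite k0reprK. Qed.

Lemma k0addE w w' : k0add (k0class w) (k0class w') = k0class (w ++ w').
Proof. by apply/k0classP/k0rel_cat; exact: k0rel_repr. Qed.

Lemma k0addA : associative k0add.
Proof.
move=> a b c; rewrite -[a]k0reprK -[b]k0reprK -[c]k0reprK.
by rewrite !k0addE catA.
Qed.

Lemma k0addC : commutative k0add.
Proof. move=> a b; apply/k0classP; exact: k0rel_comm. Qed.

Lemma k0add0 : left_id k0zero k0add.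
Proof. by move=> a; rewrite -[a]k0reprK k0addE. Qed.

Lemma k0addN : left_inverse k0zero k0opp k0add.
Proof.
move=> a; rewrite /k0opp -[in X in k0add _ X](k0reprK a) k0addE; apply/k0classP.
elim: (k0repr a) => [|[b P] w IH]; first exact: k0rel_refl.
apply: (k0rel_trans (w' := [:: (~~ b, P); (b, P)] ++ (k0opp_word w ++ w))).
  apply: (k0rel_cat (w1 := [:: (~~ b, P)]) (w1' := [:: (~~ b, P)]) (k0rel_refl _)).
  rewrite [X in k0rel X](_ : _ = (k0opp_word w ++ [:: (b, P)]) ++ w) -?catA//.
  rewrite catA.
  exact: k0rel_cat (k0rel_comm _ [:: (b, P)]) (k0rel_refl w).
by apply: (k0rel_cat (w1' := [::])) => //; rewrite -{2}[b]negbK; exact: k0rel_opp.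
Qed.

Definition k0altsum (a : nat -> K0) (n : nat) : K0 :=
  foldr k0add k0zero [seq if odd i then k0opp (a i) else a i | i <- iota 0 n].
End K0.

Section FinitenessObstruction.
Context (R : realType) (Gam : category).

Record fg_resolution := FGResolution {
  fgres :> resolution (cm_const R Gam);
  fgres_fg : forall n, fg_projective (fgres n);
  fgres_len : nat;
  fgres_zero : forall n, (fgres_len <= n)%N -> forall x (p : fgres n x), p = 0 }.

Definition type_FP : Prop := inhabited fg_resolution.

Definition obstruction (P : fg_resolution) : K0 R Gam :=
  k0altsum (fun n => k0gen (FGProj (fgres_fg P n))) (fgres_len P).

Definition is_finiteness_obstruction (o : K0 R Gam) : Prop :=
  exists P : fg_resolution, o = obstruction P.
End FinitenessObstruction.

Section L2Type.
Context (R : realType) (Gam : category).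
(* rep is a choice of a representative of each isomorphism class. *)
Context (rep : isocl Gam -> Gam).

Definition projective_resolution (P : resolution (cm_const R Gam)) : Prop :=
  forall n, projective (P n).

Definition L2_resolution (P : resolution (cm_const R Gam)) : Prop :=
  projective_resolution P /\
  (\esum_(c in [set: isocl Gam]) h2 (vnsplitting_complex (rep c) P) < +oo)%E.

Definition type_L2 : Prop := exists P, L2_resolution P.

Definition is_chif2 (chi : isocl Gam -> R) : Prop :=
  exists2 P, L2_resolution P &
    chi = fun c => chi2 (vnsplitting_complex (rep c) P).

(* U(Gam) (x)_Z R is the real vector space with basis isocl Gam.              *)
Definition is_rk2 (rk : K0 R Gam -> {freeg (isocl Gam) / R}) : Prop :=
  (forall a b, rk (k0add a b) = rk a + rk b) /\
  (forall (P : fgproj R Gam) c,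
     (coeff c (rk (k0gen P)))%:E = vndim (vnsplitting (rep c) P)).
End L2Type.

(* Main.v *)
From HB Require Import structures.
Require Import Defs.
From mathcomp Require Import all_boot all_order all_algebra.
From mathcomp Require Import complex freeg finmap.
From mathcomp Require Import all_classical all_reals ereal topology normedtype.
From mathcomp Require Import sequences esum ring lra.
Import Defs.

(** Write N for the group von Neumann algebra of aut(x) and F_x for the functor
    M |-> S_x M (x)_C[x] N.

    Let P be a finite resolution of the constant module by f.g. projectives.
    F_x is additive, so it keeps retracts, and direct finiteness makes F_x of a
    free module on n objects a retract of N^n: a composite with a factor that is
    not invertible is not invertible, so the non-isomorphisms x -> y span exactly
    the part of C mor(x, y) that S_x kills, and the isomorphisms form one free
    orbit of aut(x) ([vnfree_retract]).  Hence F_x P is a finite complex of f.g.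
    projective N-modules, nonzero for finitely many classes of x only.  Its
    Euler characteristic can be computed from the modules or from their
    homology ([vndim_homology], [euler_characteristic]); the first is the rank
    of the finiteness obstruction, the second is the L2-Euler characteristic.
    Any other projective resolution Q is chain homotopy equivalent to P, a
    relation that additive functors preserve, so it gives the same homology
    dimensions ([vndim_homology_resolution]).  Finally the rank respects the
    relations of K_0 because exact sequences of projectives split
    ([rk2_at_exact], [rkword_rel]).

    The analytic content is the dimension theory of N.  A submodule of an
    N-module need not be finitely generated, and the homology of F_x P need not
    be projective; what is used is that a matrix a over N has a kernel and a
    cokernel that are images of idempotents p and q, with
    n - tr p = m - tr q ([rank_theorem]).  Monotonicity of the dimension
    ([mxdim_inj]) and the dimension of a quotient by the image of a matrix
    ([vndim_quot]) then follow by matrix algebra.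

    For the rank theorem, N acts on l2(G) and p, q are the orthogonal
    projections onto the kernels of the bounded operator T of a and of its
    adjoint.  Instead of a polar decomposition, the equality of traces is
    obtained from an approximation: if T' is a small positive multiple of the
    adjoint, (1 - T'T)^k converges weakly to p and (1 - TT')^k to q
    ([kernel_projection]), while n - tr (1 - T'T)^k = m - tr (1 - TT')^k for all
    k by cyclicity of the trace ([mxdim_complpow]). *)

Set Implicit Arguments.
Unset Strict Implicit.
Unset Printing Implicit Defensive.
Import Order.TTheory GRing.Theory Num.Theory.
Import numFieldNormedType.Exports.
Local Open Scope classical_set_scope.
Local Open Scope ring_scope.

(** * Kernel projections of bounded operators between Hilbert spaces *)
Section Hilbert.
Context (R : realType).
Local Notation C := R[i].

(** The inner product is the real part of the usual one, which determines it:
    [ipZ] says that multiplication by a has adjoint multiplication by its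
    conjugate.  Norms occur squared throughout, and completeness is stated for
    sequences that are Cauchy with an explicit rate for the squared distance. *)
Record hilbert (V : lmodType C) := Hilbert {
  ip :> V -> V -> R;
  ipC : forall u v, ip u v = ip v u;
  ipDl : forall u v w, ip (u + v) w = ip u w + ip v w;
  ipZl : forall (r : R) u v, ip (r%:C%C *: u) v = r * ip u v;
  ipZ : forall (a : C) u v, ip (a *: u) v = ip u (conjc a *: v);
  ip_ge0 : forall u, 0 <= ip u u;
  ip_eq0 : forall u, ip u u = 0 -> u = 0;
  ip_complete : forall (u : nat -> V) (e : nat -> R),
    e n @[n --> \oo] --> 0 ->
    (forall k m n, (k <= m)%N -> (k <= n)%N ->
      ip (u m - u n) (u m - u n) <= e k) ->
    exists v, ip (u k - v) (u k - v) @[k --> \oo] --> 0 }.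

Section OneSpace.
Context (V : lmodType C) (H : hilbert V).
Local Notation nrm v := (H v v).
Implicit Types u v w : V.

Lemma ipDr u v w : H u (v + w) = H u v + H u w.
Proof. by rewrite ipC ipDl ![H _ u]ipC. Qed.

Lemma ipZr (r : R) u v : H u (r%:C%C *: v) = r * H u v.
Proof. by rewrite ipC ipZl ipC. Qed.

Lemma ip0l u : H 0 u = 0.
Proof. by apply: (addrI (H 0 u)); rewrite -ipDl !addr0. Qed.

Lemma ipNl u v : H (- u) v = - H u v.
Proof. by apply/eqP; rewrite -addr_eq0 -ipDl addNr ip0l. Qed.

Lemma ip0r u : H u 0 = 0.
Proof. by rewrite ipC ip0l. Qed.

Lemma ipNr u v : H u (- v) = - H u v.
Proof. by rewrite ipC ipNl ipC. Qed.

Lemma ipBl u v w : H (u - v) w = H u w - H v w.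
Proof. by rewrite ipDl ipNl. Qed.

Definition ipE := (ipDl, ipDr, ipZl, ipZr, ipNl, ipNr, ip0l, ip0r).

Lemma cauchy_schwarz u v : H u v ^+ 2 <= nrm u * nrm v.
Proof.
have [v0|vN0] := eqVneq (nrm v) 0.
  by rewrite (ip_eq0 v0) !ipE mulr0 expr0n.
have v_gt0 : 0 < nrm v by rewrite lt_def vN0 ip_ge0.
have := ip_ge0 H ((nrm v)%:C%C *: u - (H u v)%:C%C *: v).
rewrite !ipE (ipC H v u) => h.
rewrite -(ler_pM2l v_gt0) -subr_ge0; apply: (le_trans h).
by rewrite le_eqVlt; apply/orP; left; apply/eqP; ring.
Qed.

Lemma nrmD_le u v : nrm (u + v) <= 2 * nrm u + 2 * nrm v.
Proof.
by have := ip_ge0 H (u - v); rewrite !ipE (ipC H v u); lra.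
Qed.

Lemma nrmBC u v : nrm (u - v) = nrm (v - u).
Proof. by rewrite -opprB ipNl ipNr opprK. Qed.

Lemma ip_ext u v : (forall w, H u w = H v w) -> u = v.
Proof.
move=> uv; apply/eqP; rewrite -subr_eq0; apply/eqP/(@ip_eq0 _ H).
by rewrite ipBl uv subrr.
Qed.

Lemma le_inv_nat_eq0 (x B : R) : 0 <= x -> (forall n : nat, x * n.+1%:R <= B) -> x = 0.
Proof.
move=> x0 xB; apply/eqP; rewrite eq_le x0 andbT leNgt; apply/negP => xp.
have B0 : 0 <= B by apply: le_trans (xB 0%N); rewrite mulr_ge0.
have := archi_boundP (divr_ge0 B0 x0).
rewrite ltr_pdivrMr// => h; have := xB (Num.Def.archi_bound (B / x)).
rewrite leNgt => /negP; apply; apply: (lt_le_trans h).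
by rewrite mulrC ler_pM2l// ler_nat.
Qed.

(** The one application of completeness.  The minimum of |v|^2 - 2 phi(v) over a
    closed subspace K represents phi on K; K the whole space gives adjoints, and
    phi an inner product with a fixed vector gives orthogonal projections. *)
Lemma riesz (K : V -> Prop) (phi : V -> R) (B : R) :
  K 0 -> (forall u v, K u -> K v -> K (u + v)) ->
  (forall (r : R) u, K u -> K (r%:C%C *: u)) ->
  (forall v, (forall e : R, 0 < e -> exists2 k, K k & nrm (v - k) <= e) -> K v) ->
  (forall u v, phi (u + v) = phi u + phi v) ->
  (forall (r : R) u, phi (r%:C%C *: u) = r * phi u) ->
  0 <= B -> (forall u, phi u ^+ 2 <= B * nrm u) ->
  exists2 v, K v & forall w, K w -> H v w = phi w.
Proof.
move=> K0 KD KZ Kcl phiD phiZ B0 phiB.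
pose J v := nrm v - 2 * phi v.
have J_ge v : - B <= J v.
  have h := phiB v; have g := ip_ge0 H v; rewrite /J.
  have : 2 * phi v <= nrm v + B; last by lra.
  rewrite leNgt; apply/negP => lt.
  by have : (nrm v - B) ^+ 2 >= 0 := sqr_ge0 _; nra.
pose E := [set J v | v in K].
have E_inf : has_inf E.
  split; first by exists (J 0), 0.
  by exists (- B) => _ [v _ <-].
have Jinf v : K v -> inf E <= J v.
  by move=> Kv; apply: ge_inf; [case: E_inf|exists v].
have pos n : 0 < n.+1%:R^-1 :> R by rewrite invr_gt0.
have ex n : exists v, K v /\ J v < inf E + n.+1%:R^-1.
  by have [_ [v Kv <-] lt] := inf_adherent (pos n) E_inf; exists v.
have [u uP] := choice ex.
have lim0 : (fun n => 4 * n.+1%:R^-1 : R) n @[n --> \oo] --> 0.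
  by rewrite -[X in _ --> X](mulr0 4); apply: cvgMr; exact: cvg_harmonic.
(* By the parallelogram law, J at the midpoint bounds the distance. *)
have [v vP] : exists v, nrm (u k - v) @[k --> \oo] --> 0.
  apply: (@ip_complete _ H u _ lim0) => k m n km kn.
  have [Km Jm] := uP m; have [Kn Jn] := uP n.
  have := Jinf _ (KZ (2^-1) _ (KD _ _ Km Kn)).
  have hm : m.+1%:R^-1 <= k.+1%:R^-1 :> R by rewrite lef_pV2 ?posrE ?ler_nat.
  have hn : n.+1%:R^-1 <= k.+1%:R^-1 :> R by rewrite lef_pV2 ?posrE ?ler_nat.
  move: Jm Jn; rewrite /J phiZ phiD !ipE (ipC H (u n) (u m)).
  move: hm hn; set a := m.+1%:R^-1; set b := n.+1%:R^-1; set c := k.+1%:R^-1.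
  set i := inf E; lra.
have vlt e : 0 < e -> exists N, forall k, (N <= k)%N -> nrm (u k - v) < e.
  by move=> e0; have [N _ NP] := cvgr_lt 0 vP e e0; exists N => k /NP.
have Kv : K v.
  apply: Kcl => e /vlt[n nP]; exists (u n); first by case: (uP n).
  by rewrite nrmBC ltW// nP.
exists v => // w Kw.
have [w0|wN0] := eqVneq (nrm w) 0.
  rewrite (ip_eq0 w0) ip0r; symmetry.
  by have := phiD 0 0; rewrite addr0; lra.
have w_gt0 : 0 < nrm w by rewrite lt_def wN0 ip_ge0.
apply/eqP; rewrite -subr_eq0 -sqrf_eq0; apply/eqP.
apply: (@le_inv_nat_eq0 _ (4 * nrm w)); first exact: sqr_ge0.
move=> m; rewrite -ler_pdivlMr//.
have [N NP] := vlt _ (pos m); pose n := maxn N m.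
have [Kn Jn'] := uP n.
have Jn : J (u n) < inf E + m.+1%:R^-1.
  apply: (lt_le_trans Jn'); rewrite lerD2l lef_pV2 ?posrE// ler_nat.
  exact: leq_maxr.
(* u n almost minimizes J, so moving it by the optimal multiple - t of w gains
   at most 1/(m+1); the gain is d^2/|w|^2. *)
set d := H (u n) w - phi w.
have d_le : d ^+ 2 <= nrm w / m.+1%:R.
  pose t := d / nrm w; have tw : t * nrm w = d by rewrite /t divfK.
  have := Jinf _ (KD _ _ Kn (KZ (- t) _ Kw)).
  have -> : J (u n + (- t)%:C%C *: w) = J (u n) - t * d.
    rewrite /J phiD phiZ !ipE (ipC H w (u n)).
    have -> : H (u n) w = d + phi w by rewrite /d; ring.
    by rewrite -tw; ring.
  move: Jn; set i := inf E; set c := m.+1%:R^-1 => Jn h.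
  have : t * d <= c by lra.
  by rewrite /t mulrAC ler_pdivrMr// -expr2 [_ / m.+1%:R]mulrC.
have := cauchy_schwarz (v - u n) w.
rewrite ipBl.
have := NP n (leq_maxl _ _); rewrite nrmBC => vn cs.
have cs' : (H v w - H (u n) w) ^+ 2 <= nrm w / m.+1%:R.
  by apply: (le_trans cs); rewrite [nrm w / _]mulrC ler_pM2r// ltW.
have -> : H v w - phi w = (H v w - H (u n) w) + d by rewrite /d; ring.
rewrite -mulrA; move: cs' d_le; set x := H v w - _; set q := nrm w / _ => xq dq.
have -> : (x + d) ^+ 2 = 2 * x ^+ 2 + 2 * d ^+ 2 - (x - d) ^+ 2 by ring.
by have := sqr_ge0 (x - d); lra.
Qed.

Section Power.
Context (n : nat).
Implicit Types x y : 'I_n -> V.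

Definition ip_pow x y : R := \sum_(i < n) H (x i) (y i).

Definition hilbert_pow : hilbert ('I_n -> V).
Proof.
apply: (@Hilbert _ ip_pow) => [x y|x y z|r x y|a x y|x|x|u e e0 cau].
- by apply: eq_bigr => i _; rewrite ipC.
- by rewrite /ip_pow -big_split /=; apply: eq_bigr => i _; rewrite -ipDl.
- by rewrite /ip_pow mulr_sumr; apply: eq_bigr => i _; rewrite -ipZl.
- by apply: eq_bigr => i _; rewrite -ipZ.
- by apply: sumr_ge0 => i _; exact: ip_ge0.
- move=> /eqP; rewrite psumr_eq0 => [/allP x0|i _]; last exact: ip_ge0.
  by apply/funext => i; apply: (ip_eq0 (h := H)); apply/eqP/x0; rewrite mem_index_enum.
have /choice[v vP] i : exists v, nrm (u k i - v) @[k --> \oo] --> 0.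
  apply: (@ip_complete _ H (u^~ i) e e0) => k m l km kl.
  apply: le_trans (cau k m l km kl); rewrite /ip_pow (bigD1 i)//= lerDl.
  by apply: sumr_ge0 => j _; exact: ip_ge0.
exists v; rewrite -[X in _ --> X](@big1 _ _ +%R 'I_n (index_enum 'I_n) xpredT (fun=> 0))//.
by apply: cvg_big => [|i _]; [exact: add_continuous|exact: vP].
Defined.
End Power.
End OneSpace.

Section Adjoint.
Context (V W : lmodType C) (HV : hilbert V) (HW : hilbert W).

Lemma adjoint (T : {linear V -> W}) (B : R) :
  0 <= B -> (forall v, HW (T v) (T v) <= B * HV v v) ->
  exists T' : W -> V, [/\ linear T', forall w v, HV (T' w) v = HW w (T v)
    & forall w, HV (T' w) (T' w) <= B * HW w w].
Proof.
move=> B0 TB.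
have ex w : exists v, forall u, HV v u = HW w (T u).
  have [v _ vP] : exists2 v, True & forall u, True -> HV v u = HW w (T u).
    apply: (@riesz V HV (fun=> True) _ (HW w w * B)) => //.
    - by move=> u v; rewrite linearD ipDr.
    - by move=> r u; rewrite linearZ_LR ipZr.
    - by rewrite mulr_ge0 ?ip_ge0.
    - move=> u; apply: (le_trans (cauchy_schwarz HW _ _)).
      by rewrite -mulrA ler_wpM2l ?ip_ge0.
  by exists v => u; exact: vP.
have [T' T'P] := choice ex.
exists T'; split => //.
  move=> a u v; apply: (ip_ext (H := HV)) => w.
  by rewrite T'P !ipDl !ipZ !T'P linearZ_LR.
move=> w; set t := HV _ _.
have t0 : 0 <= t := ip_ge0 _ _.
have [->|tN0] := eqVneq t 0; first by rewrite mulr_ge0 ?ip_ge0.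
have tp : 0 < t by rewrite lt_def tN0.
rewrite -(ler_pM2l tp) -expr2 {1}/t T'P.
apply: (le_trans (cauchy_schwarz HW _ _)).
have := TB (T' w); rewrite -/t => h.
apply: (le_trans (ler_wpM2l (ip_ge0 HW w) h)).
by rewrite [leLHS](_ : _ = t * (B * HW w w))//; ring.
Qed.
End Adjoint.

(** T' is the adjoint of T up to the positive factor c, and c |T|^2 <= 1.  The
    normalization is symmetric: exchanging T and T' replaces c by its inverse
    ([adj_inv], [bound_inv]), so every statement below also holds for T'. *)
Section ErgodicKernel.
Context (V W : lmodType C) (HV : hilbert V) (HW : hilbert W).
Context (T : {linear V -> W}) (T' : {linear W -> V}) (c : R).
Context (c_gt0 : 0 < c).
Context (adj : forall w v, HV (T' w) v = c * HW w (T v)).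
Context (bound : forall v, c * HW (T v) (T v) <= HV v v).
Local Notation nV v := (HV v v).
Local Notation nW w := (HW w w).

Lemma adj_bound w : nV (T' w) <= c * nW w.
Proof.
set t := HV _ _.
have t0 : 0 <= t := ip_ge0 _ _.
have [->|tN0] := eqVneq t 0; first by rewrite mulr_ge0 ?ip_ge0// ltW.
have tp : 0 < t by rewrite lt_def tN0.
have := cauchy_schwarz HW w (T (T' w)).
have -> : HW w (T (T' w)) = t / c by rewrite /t adj mulrC mulKf ?gt_eqF.
have := bound (T' w); rewrite -/t => h cs.
have h' : nW (T (T' w)) <= t / c by rewrite ler_pdivlMr// mulrC.
have : (t / c) ^+ 2 <= nW w * (t / c).
  by apply: (le_trans cs); rewrite ler_wpM2l ?ip_ge0.
by rewrite expr2 ler_pM2r ?divr_gt0// ler_pdivrMr// mulrC.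
Qed.

Lemma bound_inv w : c^-1 * nV (T' w) <= nW w.
Proof. by rewrite ler_pdivrMl// adj_bound. Qed.

Lemma adj_inv v w : HW (T v) w = c^-1 * HV v (T' w).
Proof. by rewrite (ipC HV) adj mulKf ?gt_eqF// ipC. Qed.

Definition contr v := v - T' (T v).

Lemma contr_drop v : nV (contr v) + c * nW (T v) <= nV v.
Proof.
have := adj_bound (T v).
have e : HV (T' (T v)) v = c * nW (T v) by rewrite adj.
by rewrite /contr !ipE (ipC HV v) !e; lra.
Qed.

Lemma T_contr_le v : nW (T (contr v)) <= nW (T v).
Proof.
have e : HW (T v) (T (T' (T v))) = c^-1 * nV (T' (T v)).
  by rewrite adj mulKf ?gt_eqF.
have h := bound (T' (T v)).
have : nW (T (T' (T v))) <= c^-1 * nV (T' (T v)) by rewrite ler_pdivlMl.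
have : 0 <= c^-1 * nV (T' (T v)) by rewrite mulr_ge0 ?ip_ge0// invr_ge0 ltW.
by rewrite /contr linearB !ipE (ipC HW (T (T' _))) !e; lra.
Qed.

(** Each step of the iteration lowers |v|^2 by at least c |Tv|^2, and |Tv|
    itself decreases, so k c |T v_k|^2 is at most the total loss. *)
Lemma iter_contr_rate k v :
  k%:R * c * nW (T (iter k contr v)) + nV (iter k contr v) <= nV v.
Proof.
elim: k => [|k IH]; first by rewrite !mul0r add0r.
apply: le_trans IH; rewrite iterS; set u := iter k contr v.
have := contr_drop u; have h := T_contr_le u.
have : k.+1%:R * c * nW (T (contr u)) <= k.+1%:R * c * nW (T u).
  by rewrite ler_wpM2l// mulr_ge0// ltW.
move: h; set x := nW (T (contr u)); set y := nW (T u).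
rewrite -!mulrA -natr1 !mulrDl !mul1r; lra.
Qed.

Lemma iter_contrD k u v : iter k contr (u + v) = iter k contr u + iter k contr v.
Proof.
elim: k u v => // k IH u v; rewrite !iterSr -IH; congr iter.
by rewrite /contr !raddfD addrACA.
Qed.

Lemma iter_contr_fix k u : T u = 0 -> iter k contr u = u.
Proof. by move=> Tu; elim: k => //= k ->; rewrite /contr Tu raddf0 subr0. Qed.

Lemma iter_contr_comm k w : T' (T (iter k contr w)) = iter k contr (T' (T w)).
Proof.
elim: k w => // k IH w; rewrite !iterSr IH; congr iter.
by rewrite /contr !raddfB.
Qed.

(** The space splits into the kernel of S = T'T, fixed by 1 - S, and the closure
    of the range of S, where the iterates of 1 - S tend to 0 by
    [iter_contr_rate].  The kernels of S and T agree.  P is the complement of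
    the orthogonal projection Y onto the closure of the range. *)
Lemma kernel_projection : exists P : V -> V,
  [/\ forall u, T (P u) = 0, forall u k, T k = 0 -> HV (u - P u) k = 0
    & forall u v, HV (iter k contr u) v @[k --> \oo] --> HV (P u) v].
Proof.
pose S v := T' (T v).
have SD u v : S (u + v) = S u + S v by rewrite /S !raddfD.
have SZ a u : S (a *: u) = a *: S u by rewrite /S !linearZ_LR.
have S_sym u v : HV (S u) v = HV u (S v) by rewrite adj adj_inv mulVKf ?gt_eqF.
(* K is the closure of the range of S. *)
pose K y := forall e : R, 0 < e -> exists w, nV (y - S w) <= e.
have ex : (forall u, exists2 y, K y & forall w, K w -> HV y w = HV u w).
  move=> u; apply: (@riesz V HV K (HV u) (nV u)); rewrite ?ip_ge0//.
  - by move=> e e0; exists 0; rewrite /S !raddf0 addr0 ip0l ltW.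
  - move=> v w Kv Kw e e0.
    have e4 : 0 < e / 4 by rewrite divr_gt0.
    have [a aP] := Kv _ e4; have [b bP] := Kw _ e4; exists (a + b).
    rewrite SD opprD addrACA; apply: (le_trans (nrmD_le _ _ _)); lra.
  - move=> r v Kv e e0.
    have r0 : 0 < 1 + r ^+ 2 by have := sqr_ge0 r; lra.
    have [a aP] := Kv (e / (1 + r ^+ 2)) (divr_gt0 e0 r0).
    exists (r%:C%C *: a); rewrite SZ -scalerBr ipZl ipZr mulrA -expr2.
    have := ip_ge0 HV (v - S a) => h.
    move: aP; rewrite ler_pdivlMr// mulrC mulrDl mul1r => aP.
    by apply: le_trans aP; rewrite lerDr.
  - move=> v Kv e e0; have e4 : 0 < e / 4 by rewrite divr_gt0.
    have [k Kk vk] := Kv _ e4; have [w wk] := Kk _ e4; exists w.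
    rewrite -(subrK k v) -addrA; apply: (le_trans (nrmD_le _ _ _)); lra.
  - by move=> v w; rewrite ipDr.
  - by move=> r v; rewrite ipZr.
  - by move=> v; exact: cauchy_schwarz.
have /choice[Y YP] u : exists y, K y /\ forall w, K w -> HV y w = HV u w.
  by have [y Ky yP] := ex u; exists y.
have YS u w : HV (u - Y u) (S w) = 0.
  apply/eqP; rewrite ipBl subr_eq0; apply/eqP/esym; apply: (YP u).2 => e e0.
  by exists w; rewrite subrr ip0l ltW.
have Ycontr k u : nV (iter k contr u) <= nV u.
  have := iter_contr_rate k u.
  have : 0 <= k%:R * c * nW (T (iter k contr u)) by rewrite !mulr_ge0 ?ip_ge0// ltW.
  by lra.
pose P u := u - Y u; have TP u : T (P u) = 0.
  have SP0 : S (P u) = 0.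
    by apply: (ip_ext (H := HV)) => w; rewrite S_sym YS ip0l.
  by apply: (ip_eq0 (h := HW)); rewrite adj_inv -/(S _) SP0 ip0r mulr0.
exists P; split => // [u k Tk|u v].
  rewrite /P opprB addrC subrK; apply/eqP; rewrite -sqrf_eq0; apply/eqP.
  apply: (@le_inv_nat_eq0 _ (nV k)); first exact: sqr_ge0.
  move=> n; have n0 : 0 < n.+1%:R^-1 :> R by rewrite invr_gt0.
  have [w wP] := (YP u).1 _ n0.
  have -> : HV (Y u) k = HV (Y u - S w) k.
    by rewrite ipBl S_sym /S Tk raddf0 ip0r subr0.
  rewrite -ler_pdivlMr// mulrC; apply: (le_trans (cauchy_schwarz HV _ _)).
  by rewrite ler_wpM2r ?ip_ge0.
rewrite [X in X @ _ --> _](_ : _ = fun k => HV (P u) v + HV (iter k contr (Y u)) v); last first.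
  apply/funext => k; rewrite -ipDl -{1}(subrK (Y u) u) iter_contrD.
  by rewrite (iter_contr_fix _ (TP u)).
rewrite -[X in _ --> X]addr0; apply: cvgD; first exact: cvg_cst.
apply/cvgr0Pnorm_le => e e0.
have v1 : 0 < nV v + 1 by have := ip_ge0 HV v; lra.
(* The iterate of Y u will have squared norm at most 4 d: half of it from
   approximating Y u by S w, half from the decay on S w.  Adding 1 to |v|^2
   avoids dividing by 0. *)
pose d := e ^+ 2 / (4 * (nV v + 1)).
have d0 : 0 < d by rewrite divr_gt0 ?exprn_gt0 ?mulr_gt0.
have [w wP] := (YP u).1 _ d0.
exists (Num.Def.archi_bound (nV w / d)).+1 => // k /= hk.
have k0 : 0 < k%:R :> R by rewrite ltr0n (leq_ltn_trans _ hk).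
have wk : nV w / k%:R <= d.
  rewrite ler_pdivrMr// mulrC -ler_pdivrMr//.
  apply: (le_trans (ltW (archi_boundP _))); first by rewrite divr_ge0 ?ip_ge0// ltW.
  by rewrite ler_nat ltnW.
have Sk : nV (iter k contr (S w)) <= d.
  rewrite -iter_contr_comm; apply: (le_trans (adj_bound _)); apply: le_trans wk.
  rewrite ler_pdivlMr// [leLHS](_ : _ = k%:R * c * nW (T (iter k contr w))); last by ring.
  by have := iter_contr_rate k w; have := ip_ge0 HV (iter k contr w); lra.
rewrite -ler_sqr ?nnegrE// ?(ltW e0)// real_normK ?num_real//.
apply: (le_trans (cauchy_schwarz HV _ _)).
have Yk : nV (iter k contr (Y u)) <= 4 * d.
  rewrite -(subrK (S w) (Y u)) iter_contrD.
  apply: (le_trans (nrmD_le _ _ _)).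
  by have := Ycontr k (Y u - S w); lra.
apply: (@le_trans _ _ (4 * d * nV v)); first by rewrite ler_wpM2r ?ip_ge0.
apply: (@le_trans _ _ (4 * d * (nV v + 1))).
  by rewrite ler_wpM2l ?lerDl// mulr_ge0// ltW.
by rewrite mulrAC /d mulrC divfK// gt_eqF// mulr_gt0.
Qed.
End ErgodicKernel.
End Hilbert.

(** * The Hilbert space of square-summable functions on a group *)
Section Ell2Hilbert.
Context (R : realType) (G : groupType).
Local Notation C := R[i].
Local Notation L := (ell2 R G).
Implicit Types (f h : L) (s t : seq (R * L)).

Definition normsq f : R := fine (sqnorm f).

Lemma normsqE f : sqnorm f = (normsq f)%:E.
Proof.
rewrite fineK// ge0_fin_numE ?sqnorm_ge0//; exact/asboolP/ell2P.
Qed.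

(** Combinations of squared norms with nonnegative coefficients: [nsq_comb_eq]
    transports pointwise identities between squares to l2(G) without summability
    conditions.  The algebra of the inner product is derived in this way, after
    moving negative terms to the other side. *)
Definition nsq_comb s : R := \sum_(p <- s) p.1 * normsq p.2.
Definition nsq_comb_at s (g : G) : R := \sum_(p <- s) p.1 * nsq (p.2 g).

Lemma esumZ (c : R) (a : G -> R) : 0 <= c -> (forall g, 0 <= a g) ->
  (\esum_(g in [set: G]) (c * a g)%:E = c%:E * \esum_(g in [set: G]) (a g)%:E)%E.
Proof.
move=> c0 a0; apply/eqP; rewrite eq_le esum_scale_le//=.
have [->|cN0] := eqVneq c 0.
  by rewrite mul0e; apply: esum_ge0 => g _; rewrite lee_fin mul0r.
have cp : 0 < c by rewrite lt_def cN0.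
rewrite -lee_pdivlMl//.
have ca0 g : 0 <= c * a g by rewrite mulr_ge0.
have ci0 : 0 <= c^-1 by rewrite invr_ge0.
apply: le_trans (esum_scale_le ci0 ca0).
by apply: le_esum => g _; rewrite mulKf.
Qed.

Lemma esum_nsq_comb s : all (fun p => 0 <= p.1) s ->
  (\esum_(g in [set: G]) (nsq_comb_at s g)%:E = (nsq_comb s)%:E)%E.
Proof.
elim: s => [_|[c f] s IH /= /andP[c0 s0]].
  by rewrite esum1 /nsq_comb ?big_nil// => g _; rewrite /nsq_comb_at big_nil.
rewrite /nsq_comb big_cons EFinD -/(nsq_comb s) -IH// EFinM -normsqE -esumZ//; last first.
  by move=> g; exact: nsq_ge0.
rewrite -esumD => [|g _|g _].
- by apply: eq_esum => g _; rewrite /nsq_comb_at big_cons EFinD.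
- by rewrite lee_fin mulr_ge0 ?nsq_ge0.
- rewrite lee_fin; elim: s s0 {IH} => [_|[d k] s IH /= /andP[d0 s0]].
    by rewrite /nsq_comb_at big_nil.
  by rewrite /nsq_comb_at big_cons addr_ge0 ?mulr_ge0 ?nsq_ge0//; exact: IH.
Qed.

Lemma nsq_comb_eq s t : all (fun p => 0 <= p.1) s -> all (fun p => 0 <= p.1) t ->
  (forall g, nsq_comb_at s g = nsq_comb_at t g) -> nsq_comb s = nsq_comb t.
Proof.
move=> s0 t0 st; have := esum_nsq_comb s0; rewrite (eq_esum (b := fun g => (nsq_comb_at t g)%:E)).
  by rewrite esum_nsq_comb// => -[->].
by move=> g _; rewrite st.
Qed.

Lemma normsq_ge0 f : 0 <= normsq f.
Proof. by rewrite fine_ge0 ?sqnorm_ge0. Qed.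

(** The real part of the inner product, by polarization. *)
Definition ell2_ip f h : R := (normsq (f + h) - normsq f - normsq h) / 2.

Ltac unfold_combs := rewrite /nsq_comb /nsq_comb_at /= ?big_cons ?big_nil /=.
Ltac pointwise := move=> g; unfold_combs; rewrite ?(addrfctE, scalrfctE) /=.

Lemma ell2_ipC f h : ell2_ip f h = ell2_ip h f.
Proof. by rewrite /ell2_ip (addrC f h); congr (_ / 2); ring. Qed.

Lemma normsqZ (a : C) f : normsq (a *: f) = nsq a * normsq f.
Proof.
have : nsq_comb [:: (1, a *: f)] = nsq_comb [:: (nsq a, f)].
  apply: nsq_comb_eq; rewrite /= ?ler01 ?nsq_ge0//.
  by pointwise; rewrite nsqM; ring.
by unfold_combs; rewrite mul1r !addr0.
Qed.

Lemma ell2_ipff f : ell2_ip f f = normsq f.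
Proof.
rewrite /ell2_ip -[X in X + X]scale1r -scalerDl normsqZ.
have -> : nsq (1 + 1 : C) = 4 by rewrite /nsq /=; ring.
by field.
Qed.

(** Both sides expand, by polarization, into one linear relation among the
    squared norms of the partial sums of f, f', h. *)
Lemma ell2_ipDl f f' h : ell2_ip (f + f') h = ell2_ip f h + ell2_ip f' h.
Proof.
have : nsq_comb [:: (1, f + f' + h); (1, f); (1, f'); (1, h)] =
       nsq_comb [:: (1, f + f'); (1, f + h); (1, f' + h)].
  apply: nsq_comb_eq; rewrite /= ?ler01 ?nsq_ge0//.
  pointwise; case: (f g) (f' g) (h g) => [a b] [c d] [x y].
  by rewrite /nsq /=; ring.
by unfold_combs; rewrite /ell2_ip; lra.
Qed.

Lemma ell2_ipZ (a : C) f h : ell2_ip (a *: f) h = ell2_ip f (conjc a *: h).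
Proof.
have : nsq_comb [:: (1, a *: f + h); (1, f); (nsq a, h)] =
       nsq_comb [:: (1, f + conjc a *: h); (nsq a, f); (1, h)].
  apply: nsq_comb_eq; rewrite /= ?ler01 ?nsq_ge0//.
  pointwise; case: a (f g) (h g) => [a b] [c d] [x y].
  by rewrite /nsq /=; ring.
rewrite /ell2_ip !normsqZ (_ : nsq (conjc a) = nsq a); first by unfold_combs; lra.
by case: a => a b; rewrite /nsq /= sqrrN.
Qed.

Lemma ell2_ipZl (r : R) f h : ell2_ip (r%:C%C *: f) h = r * ell2_ip f h.
Proof.
wlog r0 : r / 0 <= r.
  move=> H; have [/H//|r0] := leP 0 r.
  have := H (- r); rewrite oppr_ge0 ltW// => /(_ isT) e.
  have z : ell2_ip 0 h = 0 by have := ell2_ipDl 0 0 h; rewrite addr0; lra.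
  have := ell2_ipDl (r%:C%C *: f) ((- r)%:C%C *: f) h.
  by rewrite -scalerDl -rmorphD subrr rmorph0 scale0r z e; lra.
have : nsq_comb [:: (1, r%:C%C *: f + h); (r, f); (r, h)] =
       nsq_comb [:: (r ^+ 2, f); (1, h); (r, f + h)].
  apply: nsq_comb_eq; rewrite /= ?ler01 ?sqr_ge0 ?r0//.
  pointwise; case: (f g) (h g) => [c d] [x y].
  by rewrite /nsq /=; ring.
have -> : ell2_ip (r%:C%C *: f) h =
    (normsq (r%:C%C *: f + h) - r ^+ 2 * normsq f - normsq h) / 2.
  by rewrite /ell2_ip normsqZ /nsq /= expr0n addr0.
by rewrite /ell2_ip; unfold_combs; lra.
Qed.

Lemma nsq_le_normsq f g : nsq (f g) <= normsq f.
Proof.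
rewrite -lee_fin -normsqE; apply: esum_ge; exists [set g] => //.
by rewrite fsbig_set1.
Qed.

Lemma nsq_eq0 (z : C) : nsq z = 0 -> z = 0.
Proof.
case: z => a b; rewrite /nsq /= => /eqP.
by rewrite paddr_eq0 ?sqr_ge0// !sqrf_eq0 => /andP[/eqP-> /eqP->].
Qed.

Lemma normsq_eq0 f : normsq f = 0 -> f = 0.
Proof.
move=> f0; apply: ell2_eqP => g; apply: nsq_eq0; apply/eqP.
by rewrite eq_le nsq_ge0 -f0 nsq_le_normsq.
Qed.

Lemma sqnorm_le (f : G -> C) (e : R) :
  (forall F : seq G, uniq F -> \sum_(g <- F) nsq (f g) <= e) ->
  (sqnorm f <= e%:E)%E.
Proof.
move=> Fe; apply: ge_ereal_sup => /= _ [X [finX _] <-].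
rewrite fsumEFin// lee_fin fsbig_finite//=; apply: Fe; exact: fset_uniq.
Qed.

Lemma psum_le_normsq f (F : seq G) : uniq F -> \sum_(g <- F) nsq (f g) <= normsq f.
Proof.
move=> uF; rewrite -lee_fin -normsqE; apply: esum_ge; exists [set` F].
  by split => //; exact: finite_seq.
by rewrite -fsbig_seq// sumEFin.
Qed.

(** The limit is taken pointwise; finite partial sums pass to the limit, and they
    bound the squared norm. *)
Lemma ell2_complete (u : nat -> L) (e : nat -> R) :
    e n @[n --> \oo] --> 0 ->
    (forall k m n, (k <= m)%N -> (k <= n)%N -> normsq (u m - u n) <= e k) ->
    exists v, forall k, normsq (u k - v) <= e k.
Proof.
move=> e0 cau.
have cv (p : {additive C -> R}) : (forall z, p z ^+ 2 <= nsq z) ->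
    forall g, cvg (p (u n g) @[n --> \oo]).
  move=> pz g; apply: cauchy_cvg; apply: cauchy_exP => eps eps0.
  have /cvgr_lt/(_ (eps ^+ 2) (exprn_gt0 2 eps0)) := e0.
  case=> k _ /(_ k (leqnn k)) /= ek; exists (p (u k g)), k => // n /= kn.
  rewrite /ball /= -ltr_sqr ?nnegrE// ?(ltW eps0)// real_normK ?num_real//.
  apply: le_lt_trans ek; apply: le_trans (cau k k n (leqnn _) kn).
  rewrite -raddfB; apply: (le_trans (pz _)); exact: (nsq_le_normsq (u k - u n) g).
have cRe g : cvg (complex.Re (u n g) @[n --> \oo]).
  by apply: cv => -[a b]; rewrite /nsq /= lerDl sqr_ge0.
have cIm g : cvg (complex.Im (u n g) @[n --> \oo]).
  by apply: cv => -[a b]; rewrite /nsq /= lerDr sqr_ge0.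
pose v g : C := Complex (lim (complex.Re (u n g) @[n --> \oo]))
  (lim (complex.Im (u n g) @[n --> \oo])).
have vle k (F : seq G) : uniq F -> \sum_(g <- F) nsq (u k g - v g) <= e k.
  move=> uF.
  have ct : \sum_(g <- F) nsq (u k g - u n g) @[n --> \oo] -->
      \sum_(g <- F) nsq (u k g - v g).
    apply: cvg_big => [|g _]; first exact: add_continuous.
    apply: cvgD; rewrite expr2; under eq_fun do rewrite expr2 raddfB.
      by rewrite raddfB; apply: cvgM; apply: cvgB; by [exact: cvg_cst|exact: cRe].
    by rewrite raddfB; apply: cvgM; apply: cvgB; by [exact: cvg_cst|exact: cIm].
  rewrite -(cvg_lim _ ct)//; apply: limr_le; first by apply/cvg_ex; eexists; exact: ct.
  exists k => // n /= kn; apply: le_trans (cau k k n (leqnn _) kn).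
  exact: (psum_le_normsq (u k - u n) uF).
have v2 k : ell2_fun (u k) - v \in @ell2p R G.
  apply/asboolP; apply: (@le_lt_trans _ _ (e k)%:E); last by rewrite ltry.
  by apply: sqnorm_le; exact: vle.
have vP : v \in @ell2p R G.
  rewrite (_ : v = ell2_fun (u 0%N) - (ell2_fun (u 0%N) - v)).
    exact: rpredB (ell2P _) (v2 _).
  by rewrite opprB addrC subrK.
exists (Ell2 vP) => k; rewrite -lee_fin -normsqE; apply: sqnorm_le; exact: vle.
Qed.

Definition ell2_hilbert : hilbert L.
Proof.
apply: (@Hilbert R L ell2_ip ell2_ipC ell2_ipDl ell2_ipZl ell2_ipZ) => [u|u|u e e0 cau].
- by rewrite ell2_ipff normsq_ge0.
- by rewrite ell2_ipff; exact: normsq_eq0.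
- have [|v vP] := ell2_complete e0 (u := u).
    by move=> k m n km kn; rewrite -ell2_ipff cau.
  exists v; apply: (@squeeze_cvgr _ _ _ _ (fun=> 0) e) => //; last exact: cvg_cst.
  by exists 0%N => // k _ /=; rewrite ell2_ipff normsq_ge0 vP.
Defined.

Lemma normsq_delta g : normsq (delta R g) = 1.
Proof.
pose a (k : G) := (nsq ((k == g)%:R : C))%:E.
have a0 k : (0 <= a k)%E by rewrite lee_fin nsq_ge0.
rewrite /normsq (_ : sqnorm _ = \esum_(k in [set g]) a k)%E.
  by rewrite esum_set1// /a eqxx /nsq /= expr0n addr0 expr1n.
rewrite esum_mkcond; apply: eq_esum => k _; case: ifPn => //.
rewrite notin_setE/= => /eqP/negPf; rewrite /a => ->.
by rewrite /nsq /= expr0n addr0.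
Qed.

Lemma ell2_ip_delta f g : ell2_ip f (delta R g) = complex.Re (f g).
Proof.
have : nsq_comb [:: (1, f + delta R g); (1, f g *: delta R g)] =
       nsq_comb [:: (1, f); (1, (f g + 1) *: delta R g)].
  apply: nsq_comb_eq; rewrite /= ?ler01//.
  move=> k; unfold_combs; rewrite ?(addrfctE, scalrfctE) /=.
  have [->|_] := eqVneq k g; first by rewrite /= ![_ *: _]mulr1; ring.
  by rewrite !scaler0 addr0.
unfold_combs; rewrite !normsqZ /ell2_ip normsq_delta; case: (f g) => a b.
by rewrite /nsq /=; lra.
Qed.

(** f^*(g) = conj f(g^-1), the involution that sends T delta_1 to
    T^* delta_1 for T in the von Neumann algebra. *)
Definition flip_fun (f : G -> C) (g : G) : C := conjc (f g^-1%g).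

Lemma nsq_conj (z : C) : nsq (conjc z) = nsq z.
Proof. by case: z => a b; rewrite /nsq /= sqrrN. Qed.

Lemma sqnorm_flip (f : G -> C) : sqnorm (flip_fun f) = sqnorm f.
Proof.
rewrite -(@sqnorm_bij R G (fun g => g^-1)%g f); last by exists (fun g => g^-1)%g => ?; rewrite invgK.
by apply: eq_esum => g _; rewrite nsq_conj.
Qed.

Lemma flip_subproof f : flip_fun f \in @ell2p R G.
Proof. by apply/asboolP; rewrite sqnorm_flip; exact/asboolP/ell2P. Qed.

Definition flip f : L := Ell2 (flip_subproof f).

Lemma flipK : involutive flip.
Proof.
by move=> f; apply: ell2_eqP => g; rewrite /= /flip_fun /= /flip_fun invgK conjcK.
Qed.

Lemma ell2_ip_flip f h : ell2_ip (flip f) (flip h) = ell2_ip f h.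
Proof.
have nf k : normsq (flip k) = normsq k by rewrite /normsq sqnorm_flip.
rewrite /ell2_ip !nf (_ : flip f + flip h = flip (f + h)) ?nf//.
by apply: ell2_eqP => g; rewrite /= /flip_fun /= !addrfctE rmorphD.
Qed.

Lemma ell2_ip_rtrans g f h : ell2_ip (rtrans g f) (rtrans g h) = ell2_ip f h.
Proof.
have nf k : normsq (rtrans g k) = normsq k.
  by rewrite /normsq sqnorm_bij//; exact: mulgr_bij.
rewrite /ell2_ip !nf (_ : rtrans g f + rtrans g h = rtrans g (f + h)) ?nf//.
exact: ell2_eqP.
Qed.
End Ell2Hilbert.

(** * The trace of the group von Neumann algebra *)
HB.instance Definition _ (R : realType) (G : groupType) (T : vnalg R G) :=
  GRing.isLinear.Build R[i] (ell2 R G) (ell2 R G) _ (vn_fun T) (vn_linear T).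

Section VnTrace.
Context (R : realType) (G : groupType).
Local Notation C := R[i].
Local Notation L := (ell2 R G).
Local Notation N := (vnalg R G).
Local Notation e1 := (delta R (1%g : G)).
Implicit Types (f h : L) (T : N).

Lemma vn_bounded T : exists2 B : R, 0 <= B & forall f, normsq (T f) <= B * normsq f.
Proof.
have /asboolP[_ [B B0 TB] _] := vnP T; exists B => // f.
by rewrite -lee_fin EFinM -!normsqE.
Qed.

Lemma vn_rtrans T g f : T (rtrans g f) = rtrans g (T f).
Proof. by have /asboolP[_ _ ->] := vnP T. Qed.

Lemma rtrans_delta (g : G) : rtrans g e1 = delta R g.
Proof. by apply: ell2_eqP => h; rewrite /= divg_eq1. Qed.

Lemma rtransD g f h : rtrans g (f + h) = rtrans g f + rtrans g h.
Proof. exact: ell2_eqP. Qed.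

Lemma ell2_ip_scale_delta (a : C) f g : ell2_ip f (a *: delta R g) = complex.Re (conjc a * f g).
Proof. by rewrite -[in LHS](conjcK a) -ell2_ipZ ell2_ip_delta. Qed.

(** Real inner products with delta_g and i delta_g read off the real and the
    imaginary part of the value at g. *)
Lemma ell2_ip_ext f h :
  (forall (a : C) g, ell2_ip f (a *: delta R g) = ell2_ip h (a *: delta R g)) -> f = h.
Proof.
move=> fh; apply: ell2_eqP => g.
have := fh 1 g; have := fh 'i%C g; rewrite !ell2_ip_scale_delta.
by case: (f g) (h g) => [a b] [c d] /=; 
  rewrite !(mul0r, mul1r, sub0r, oppr0, subr0, mulN1r, opprK) => -> ->.
Qed.

(** T delta_g is the right translate of T delta_1, so the value of T^* delta_1 at
    g, which is <delta_1, T delta_g>, is the conjugate of (T delta_1)(g^-1). *)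
Lemma vn_adjoint T : exists T' : L -> L,
  (forall f h, ell2_ip (T' f) h = ell2_ip f (T h)) /\ T' e1 = flip (T e1).
Proof.
have [B B0 TB] := vn_bounded T.
have [|T' [_ T'P _]] := @adjoint R L L (ell2_hilbert R G) (ell2_hilbert R G) (vn_fun T) B B0.
  by move=> f; rewrite /= !ell2_ipff.
exists T'; split; first exact: T'P.
have Tg g : T (delta R g) = rtrans g (T e1) by rewrite -vn_rtrans rtrans_delta.
apply: ell2_ip_ext => a g; rewrite [LHS]T'P linearZ_LR /= (Tg g) ell2_ip_scale_delta.
rewrite [LHS]ell2_ipC ell2_ip_delta /= /flip_fun !(addrfctE, scalrfctE) /= mul1g.
by case: a ((T _) _) => [a b] [c d] /=; ring.
Qed.

(** tr(ST) = <T delta_1, S^* delta_1> = <T delta_1, (S delta_1)^*>, and the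
    involution is isometric, which makes this symmetric in S and T. *)
Lemma vntr_mulC (S T : N) : complex.Re (vntr (S * T)) = complex.Re (vntr (T * S)).
Proof.
have tr (U U' : N) : complex.Re (vntr (U * U')) = ell2_ip (U' e1) (flip (U e1)).
  have [V [adj V1]] := vn_adjoint U.
  by rewrite /vntr -ell2_ip_delta -V1 [RHS]ell2_ipC adj [RHS]ell2_ipC.
by rewrite !tr -[in RHS]ell2_ip_flip flipK ell2_ipC.
Qed.
End VnTrace.

(** * Matrices over the von Neumann algebra as equivariant operators *)
Section Operators.
Context (R : realType) (G : groupType).
Local Notation C := R[i].
Local Notation L := (ell2 R G).
Local Notation N := (vnalg R G).
Local Notation e1 := (delta R (1%g : G)).
Local Notation H n := ('I_n -> L).
Local Notation ipn n := (hilbert_pow (ell2_hilbert R G) n).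

(** Matrices over the converse ring act on row vectors from the right, so
    [mxop (a *m b)] is [mxop b] after [mxop a]. *)
Definition mxop n m (a : 'M[N^c]_(n, m)) (f : H n) : H m :=
  fun j => \sum_(i < n) (a i j : N) (f i).

Lemma mxop_is_linear n m (a : 'M[N^c]_(n, m)) : linear (mxop a).
Proof.
move=> c u v; apply/funext => j; rewrite /mxop !(addrfctE, scalrfctE) scaler_sumr -big_split.
by apply: eq_bigr => i _; rewrite ?(addrfctE, scalrfctE) linearP.
Qed.
HB.instance Definition _ n m (a : 'M[N^c]_(n, m)) :=
  GRing.isLinear.Build C (H n) (H m) _ (mxop a) (mxop_is_linear a).

Definition rtransv n (g : G) (f : H n) : H n := fun i => rtrans g (f i).

Definition single n (i : 'I_n) (f : L) : H n := fun k => if k == i then f else 0.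

Lemma mxop_singleE n m (a : 'M[N^c]_(n, m)) i j f : mxop a (single i f) j = (a i j : N) f.
Proof.
rewrite /mxop (bigD1 i)//= /single eqxx big1 ?addr0// => k /negPf->.
by rewrite raddf0.
Qed.

Lemma mxop_inj n m (a b : 'M[N^c]_(n, m)) : (forall f, mxop a f = mxop b f) -> a = b.
Proof.
move=> ab; apply/matrixP => i j; apply: vn_eqP => f.
by rewrite -mxop_singleE ab mxop_singleE.
Qed.

Lemma sum_vnE (I : Type) (s : seq I) (F : I -> N) (f : L) :
  (\sum_(i <- s) F i : N) f = \sum_(i <- s) F i f.
Proof. by elim: s => [|i s IH]; rewrite ?big_nil// !big_cons -IH. Qed.

Lemma mxop_mul n m l (a : 'M[N^c]_(n, m)) (b : 'M[N^c]_(m, l)) f :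
  mxop (a *m b) f = mxop b (mxop a f).
Proof.
apply/funext => j; rewrite /mxop.
transitivity (\sum_i \sum_k (b k j : N) ((a i k : N) (f i))).
  by apply: eq_bigr => i _; rewrite mxE; exact: (@sum_vnE _ _ (fun k => a i k * b k j)).
rewrite exchange_big; apply: eq_bigr => k _; rewrite raddf_sum.
exact: eq_bigr.
Qed.

Lemma mxop1 n f : mxop (1%:M : 'M[N^c]_n) f = f.
Proof.
apply/funext => j; rewrite /mxop (bigD1 j)//= mxE eqxx big1 ?addr0// => k /negPf kj.
by rewrite mxE kj.
Qed.

Lemma mxopB n m (a b : 'M[N^c]_(n, m)) f : mxop (a - b) f = mxop a f - mxop b f.
Proof.
apply/funext => j; rewrite /mxop -[RHS]sumrB.
by apply: eq_bigr => i _; rewrite !mxE.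
Qed.

Lemma mxop0 n m f : mxop (0 : 'M[N^c]_(n, m)) f = 0.
Proof. by apply/funext => j; rewrite /mxop big1// => i _; rewrite mxE. Qed.

Lemma mxop_rtransv n m (a : 'M[N^c]_(n, m)) g f : mxop a (rtransv g f) = rtransv g (mxop a f).
Proof.
apply/funext => j; rewrite /mxop /rtransv.
transitivity (\sum_i rtrans g ((a i j : N) (f i))).
  by apply: eq_bigr => i _; rewrite vn_rtrans.
elim/big_rec2: _ => [|i y1 y2 _ ->]; first exact: ell2_eqP.
by rewrite rtransD.
Qed.

Lemma ip_rtransv n g (u v : H n) : ipn n (rtransv g u) (rtransv g v) = ipn n u v.
Proof. by apply: eq_bigr => i _; exact: ell2_ip_rtrans. Qed.

Lemma rtransvK n g : cancel (@rtransv n g^-1%g) (rtransv g).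
Proof.
move=> f; apply/funext => i; apply: ell2_eqP => h.
by rewrite /rtransv /= invgK -mulgA mulVg mulg1.
Qed.

Lemma ip_rtransvC n g (u v : H n) : ipn n (rtransv g u) v = ipn n u (rtransv g^-1%g v).
Proof. by rewrite -[RHS](ip_rtransv g) rtransvK. Qed.

Lemma mxop_bounded n m (a : 'M[N^c]_(n, m)) :
  exists2 B : R, 0 <= B & forall f, ipn m (mxop a f) (mxop a f) <= B * ipn n f f.
Proof.
have col (s : seq 'I_n) j : exists2 B : R, 0 <= B & forall f : H n,
    normsq (\sum_(i <- s) (a i j : N) (f i)) <= B * ipn n f f.
  elim: s => [|i s [B B0 IH]].
    exists 0 => // f; rewrite big_nil mul0r -ell2_ipff.
    by rewrite le_eqVlt (_ : ell2_ip _ _ = 0) ?eqxx//; exact: (ip0l (ell2_hilbert R G)).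
  have [K K0 KP] := vn_bounded (a i j : N).
  exists (2 * K + 2 * B); first by rewrite addr_ge0// mulr_ge0.
  move=> f; have le_i : normsq (f i) <= ipn n f f.
    rewrite /= /ip_pow (bigD1 i)//= ell2_ipff lerDl.
    by apply: sumr_ge0 => k _; rewrite ell2_ipff normsq_ge0.
  set r := ipn n f f in le_i IH *.
  have := nrmD_le (ell2_hilbert R G) ((a i j : N) (f i)) (\sum_(i <- s) (a i j : N) (f i)).
  rewrite big_cons ![ell2_hilbert R G _ _]ell2_ipff.
  have := IH f; have := KP (f i); have := ler_wpM2l K0 le_i.
  by rewrite -/r; set x := normsq (f i); lra.
have /choice[B BP] j : exists B : R, 0 <= B /\ forall f, normsq (mxop a f j) <= B * ipn n f f.
  by have [B B0 BP] := col (index_enum 'I_n) j; exists B.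
exists (\sum_j B j); first by apply: sumr_ge0 => j _; case: (BP j).
move=> f; rewrite mulr_suml; apply: ler_sum => j _; rewrite /= ell2_ipff.
exact: (BP j).2.
Qed.

Lemma single_linear n (i : 'I_n) : linear (single i).
Proof.
move=> a u v; apply/funext => k; rewrite /single !(addrfctE, scalrfctE).
by case: ifP => // _; rewrite scaler0 addr0.
Qed.

Lemma ip_single n (i : 'I_n) (f : L) (u : H n) : ipn n u (single i f) = ell2_ip (u i) f.
Proof.
rewrite /= /ip_pow (bigD1 i)//= /single eqxx big1 ?addr0// => k /negPf->.
exact: (ip0r (ell2_hilbert R G)).
Qed.

(** Every bounded equivariant operator is a matrix over N: this is what brings
    adjoints and orthogonal projections back into the matrix ring. *)
Lemma mxop_surj n m (F : H n -> H m) (B : R) : linear F -> 0 <= B ->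
  (forall f, ipn m (F f) (F f) <= B * ipn n f f) ->
  (forall g f, F (rtransv g f) = rtransv g (F f)) ->
  exists a : 'M[N^c]_(n, m), forall f, mxop a f = F f.
Proof.
move=> lF B0 FB Fr.
have entry i j : (fun f => F (single i f) j) \in @vnp R G.
  apply/asboolP; split=> [a u v||g f].
  - by rewrite single_linear lF.
  - exists B => // f; rewrite !normsqE -EFinM lee_fin.
    apply: (@le_trans _ _ (ipn m (F (single i f)) (F (single i f)))).
      rewrite /= /ip_pow (bigD1 j)//= ell2_ipff lerDl.
      by apply: sumr_ge0 => k _; rewrite ell2_ipff normsq_ge0.
    by apply: (le_trans (FB _)); rewrite ip_single /single eqxx ell2_ipff.
  - transitivity (F (rtransv g (single i f)) j); last by rewrite Fr.
    congr (F _ j); apply/funext => k; rewrite /rtransv /single; case: ifP => // _.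
    exact: ell2_eqP.
exists (\matrix_(i, j) (VN (entry i j) : N^c)) => f.
pose F' : {linear H n -> H m} := HB.pack F (GRing.isLinear.Build C (H n) (H m) _ F lF).
have fE : f = \sum_i single i (f i).
  apply/funext => k; rewrite -[RHS]/((fun u : H n => u k) _).
  rewrite fct_sumE (bigD1 k)//= /single eqxx big1 ?addr0// => i ik.
  by rewrite eq_sym (negPf ik).
rewrite {2}fE -[F _]/(F' _) raddf_sum; apply/funext => j.
by rewrite fct_sumE /mxop; apply: eq_bigr => i _; rewrite mxE.
Qed.

Lemma mxdimE n (a : 'M[N^c]_n) :
  mxdim a = \sum_i ipn n (mxop a (single i e1)) (single i e1).
Proof.
rewrite /mxdim raddf_sum; apply: eq_bigr => i _.
by rewrite ip_single mxop_singleE ell2_ip_delta.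
Qed.

Lemma mxdimD n (a b : 'M[N^c]_n) : mxdim (a + b) = mxdim a + mxdim b.
Proof.
rewrite /mxdim -raddfD -big_split; congr complex.Re.
by apply: eq_bigr => i _; rewrite mxE.
Qed.

Lemma mxdimN n (a : 'M[N^c]_n) : mxdim (- a) = - mxdim a.
Proof.
rewrite /mxdim -raddfN -sumrN; congr complex.Re.
by apply: eq_bigr => i _; rewrite mxE.
Qed.

Lemma mxdimB n (a b : 'M[N^c]_n) : mxdim (a - b) = mxdim a - mxdim b.
Proof. by rewrite mxdimD mxdimN. Qed.

Lemma mxdim1 n : mxdim (1%:M : 'M[N^c]_n) = n%:R.
Proof.
rewrite /mxdim raddf_sum (eq_bigr (fun=> 1)) => [|i _].
  by rewrite sumr_const card_ord.
by rewrite mxE eqxx /vntr /= eqxx.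
Qed.

Lemma mxdim0 n : mxdim (0 : 'M[N^c]_n) = 0.
Proof. by rewrite -(subrr (0 : 'M[N^c]_n)) mxdimB subrr. Qed.

(** The trace property of N, entry by entry. *)
Lemma mxdim_mulC n m (a : 'M[N^c]_(n, m)) (b : 'M[N^c]_(m, n)) :
  mxdim (a *m b) = mxdim (b *m a).
Proof.
have vtr I (s : seq I) (F : I -> N) : complex.Re (vntr (\sum_(i <- s) F i)) =
    \sum_(i <- s) complex.Re (vntr (F i)).
  by rewrite /vntr sum_vnE; elim: s => [|i s IH]; rewrite ?big_nil// !big_cons -IH -raddfD.
have tr k l (c : 'M[N^c]_(k, l)) (d : 'M[N^c]_(l, k)) :
    mxdim (c *m d) = \sum_i \sum_j complex.Re (vntr ((d j i : N) * (c i j : N))).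
  rewrite /mxdim raddf_sum; apply: eq_bigr => i _; rewrite mxE.
  exact: (vtr _ _ (fun j => c i j * d j i)).
rewrite !tr.
rewrite exchange_big; apply: eq_bigr => i _; apply: eq_bigr => j _.
exact: vntr_mulC.
Qed.
End Operators.

(** * The rank theorem *)
Section Rank.
Context (R : realType) (G : groupType).
Local Notation C := R[i].
Local Notation L := (ell2 R G).
Local Notation N := (vnalg R G).
Local Notation e1 := (delta R (1%g : G)).
Local Notation H n := ('I_n -> L).
Local Notation ipn n := (hilbert_pow (ell2_hilbert R G) n).

(** The matrix of (1 - T'T)^k when a and a' are the matrices of T and T'. *)
Definition complpow n m (a : 'M[N^c]_(n, m)) (a' : 'M[N^c]_(m, n)) (k : nat) : 'M[N^c]_n :=
  iter k (mulmx (1%:M - a *m a')) 1%:M.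

Lemma complpowE n m (a : 'M[N^c]_(n, m)) (a' : 'M[N^c]_(m, n)) k f :
  mxop (complpow a a' k) f = iter k (contr (mxop a) (mxop a')) f.
Proof.
elim: k f => [|k IH] f; first exact: mxop1.
by rewrite iterSr /complpow iterS mxop_mul -/(complpow a a' k) IH mxopB mxop1 mxop_mul.
Qed.

Lemma complpow_mulr n m (a : 'M[N^c]_(n, m)) (a' : 'M[N^c]_(m, n)) k :
  complpow a a' k *m a = a *m complpow a' a k.
Proof.
elim: k => [|k IH]; first by rewrite mul1mx mulmx1.
rewrite /complpow !iterS -!/(complpow _ _ _) -mulmxA IH !mulmxA.
by rewrite mulmxBl mulmxBr mul1mx mulmx1 !mulmxA.
Qed.

(** (1 - x)^k - (1 - x)^(k+1) is x (1 - x)^k, and the traces of aa'(1 - aa')^k and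
    a'a(1 - a'a)^k agree by cyclicity; only the k = 0 terms n and m differ. *)
Lemma mxdim_complpow n m (a : 'M[N^c]_(n, m)) (a' : 'M[N^c]_(m, n)) k :
  n%:R - mxdim (complpow a a' k) = m%:R - mxdim (complpow a' a k).
Proof.
elim: k => [|k IH]; first by rewrite !mxdim1 !subrr.
have step l q (b : 'M[N^c]_(l, q)) (b' : 'M[N^c]_(q, l)) :
    mxdim (complpow b b' k.+1) = mxdim (complpow b b' k) - mxdim (b *m b' *m complpow b b' k).
  by rewrite /complpow iterS mulmxBl mul1mx mxdimB.
have cyc : mxdim (a *m a' *m complpow a a' k) = mxdim (a' *m a *m complpow a' a k).
  by rewrite -mulmxA mxdim_mulC -mulmxA complpow_mulr mulmxA.
by rewrite !step cyc; move: IH; lra.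
Qed.

(** The orthogonal projection onto the kernel of a bounded equivariant operator is
    linear, bounded and equivariant since it is determined by the kernel, hence
    it is a matrix.  Its trace is a sum of squared norms. *)
Lemma kernel_matrix n m (a : 'M[N^c]_(n, m)) (a' : 'M[N^c]_(m, n)) (c : R) :
  0 < c -> (forall w v, ipn n (mxop a' w) v = c * ipn m w (mxop a v)) ->
  (forall v, c * ipn m (mxop a v) (mxop a v) <= ipn n v v) ->
  exists p : 'M[N^c]_n, [/\ p *m a = 0,
    forall u k, mxop a k = 0 -> ipn n (u - mxop p u) k = 0,
    0 <= mxdim p &
    mxdim (complpow a a' k) @[k --> \oo] --> mxdim p].
Proof.
move=> c0 adj bd.
have [P [aP Port Plim]] := @kernel_projection R _ _ (ipn n) (ipn m) (mxop a) (mxop a') c c0 adj bd.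
have Puniq u y : mxop a y = 0 -> (forall k, mxop a k = 0 -> ipn n (u - y) k = 0) -> y = P u.
  move=> ay uy; apply/eqP; rewrite -subr_eq0; apply/eqP/(ip_eq0 (h := ipn n)).
  have ker : mxop a (y - P u) = 0 by rewrite raddfB /= ay aP subrr.
  have e : y - P u = (u - P u) - (u - y) by rewrite opprB [RHS]addrC subrKA.
  by rewrite {1}e ipBl Port// uy// subrr.
have Psym u v : ipn n (P u) v = ipn n (P u) (P v).
  by apply/eqP; rewrite -subr_eq0 ![ipn n (P u) _]ipC -ipBl Port.
have [p pP] : exists p : 'M[N^c]_n, forall u, mxop p u = P u.
  apply: (@mxop_surj R G n n P 1) => //.
  - move=> b u v; apply/esym/Puniq; first by rewrite linearP /= !aP scaler0 addr0.
    move=> k ak; rewrite opprD addrACA -scalerBr ipDl ipZ !Port ?addr0//.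
    by rewrite linearZ_LR /= ak scaler0.
  - move=> u; set x := P u; have o : ipn n (u - x) x = 0 by apply: Port; exact: aP.
    have [y uy] : exists y, u = y + x by exists (u - x); rewrite subrK.
    move: o; rewrite mul1r uy addrK => o.
    by rewrite !ipDl !ipDr (ipC _ x y) o addr0 add0r lerDr ip_ge0.
  - move=> g u; apply/esym/Puniq.
      rewrite [LHS]mxop_rtransv aP; apply/funext => i; exact: ell2_eqP.
    move=> k ak; rewrite (_ : _ - _ = rtransv g (u - P u)); last first.
      by apply/funext => i; exact: ell2_eqP.
    rewrite ip_rtransvC; apply: Port; rewrite [LHS]mxop_rtransv ak; apply/funext => i; exact: ell2_eqP.
exists p; split.
- by apply: mxop_inj => f; rewrite mxop_mul pP aP mxop0.
- by move=> u k ak; rewrite pP Port.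
- by rewrite mxdimE; apply: sumr_ge0 => i _; rewrite pP Psym ip_ge0.
- rewrite mxdimE; under eq_fun do rewrite mxdimE.
  apply: cvg_big => [|i _]; first exact: add_continuous.
  by rewrite pP; under eq_fun do rewrite complpowE; exact: Plim.
Qed.

(** Row rank equals column rank, in the limit k -> oo of [mxdim_complpow].  The
    idempotents are the orthogonal projections onto the kernel of the operator
    and onto the kernel of its adjoint; the latter is the complement of the
    closure of the image, which is why it serves as the cokernel. *)
Theorem rank_theorem n m (a : 'M[N^c]_(n, m)) :
  exists (p : 'M[N^c]_n) (q : 'M[N^c]_m),
  [/\ p *m a = 0 /\ (forall k (v : 'M[N^c]_(k, n)), v *m a = 0 -> v *m p = v),
      a *m q = 0 /\ (forall k (b : 'M[N^c]_(m, k)), a *m b = 0 -> q *m b = b),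
      0 <= mxdim p & n%:R - mxdim p = m%:R - mxdim q].
Proof.
have [B B0 aB] := mxop_bounded a.
have adjoint_op k l (b : 'M[N^c]_(k, l)) : exists b' : 'M[N^c]_(l, k),
    forall w v, ipn k (mxop b' w) v = ipn l w (mxop b v).
  have [K K0 bK] := mxop_bounded b.
  have [T' [lT adj T'B]] := adjoint (T := mxop b) K0 bK.
  have [||b' b'P] := @mxop_surj R G l k T' K lT K0; [exact: T'B| |].
    move=> g f; apply: (ip_ext (H := ipn k)) => v.
    by rewrite adj !ip_rtransvC -mxop_rtransv -adj.
  by exists b' => w v; rewrite b'P adj.
(* B bounds |T|^2; adding 1 keeps c defined when B = 0. *)
pose c := (B + 1)^-1.
have B1 : 0 < B + 1 by lra.
have c0 : 0 < c by rewrite invr_gt0.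
have [a1 a1P] := adjoint_op _ _ a.
have [s sP] : exists s : 'M[N^c]_n, forall f, mxop s f = c%:C%C *: f.
  apply: (@mxop_surj R G n n _ (c ^+ 2)); first by move=> b u v; rewrite scalerDr !scalerA mulrC.
  - exact: sqr_ge0.
  - by move=> f; rewrite ipZl ipZr mulrA expr2.
  - by move=> g f; apply/funext => i; exact: ell2_eqP.
pose a' := a1 *m s.
have adj w v : ipn n (mxop a' w) v = c * ipn m w (mxop a v).
  by rewrite mxop_mul sP ipZl a1P.
have bd v : c * ipn m (mxop a v) (mxop a v) <= ipn n v v.
  rewrite /c ler_pdivrMl//; apply: (le_trans (aB v)).
  by rewrite mulrDl mul1r lerDl ip_ge0.
have ci0 : 0 < c^-1 by rewrite invr_gt0.
have [p [pa port p0 plim]] := kernel_matrix c0 adj bd.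
have [q [qa qort q0 qlim]] := kernel_matrix ci0
  (adj_inv c0 adj) (bound_inv c0 adj bd).
exists p, q; split=> //.
- split=> // k v va; apply: mxop_inj => f; rewrite mxop_mul.
  have Tf : mxop a (mxop v f) = 0 by rewrite -mxop_mul va mxop0.
  have pz : mxop a (mxop p (mxop v f)) = 0 by rewrite -mxop_mul pa mxop0.
  apply/esym/eqP; rewrite -subr_eq0; apply/eqP/(ip_eq0 (h := ipn n)).
  by rewrite port// raddfB /= Tf pz subrr.
- have a'q w : mxop a' (mxop q w) = 0 by rewrite -mxop_mul qa mxop0.
  split.
    apply: mxop_inj => f; rewrite mxop_mul mxop0; apply: (ip_eq0 (h := ipn m)).
    set y := mxop q _; have ya : ipn m (mxop a f) y = 0.
      rewrite (adj_inv c0 adj) (_ : (_ : {linear _ -> _}) y = 0) ?ip0r ?mulr0//; exact: a'q.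
    have := qort (mxop a f) y (a'q _); rewrite ipBl ya -/y => /eqP.
    by rewrite sub0r oppr_eq0 => /eqP.
  move=> k b ab; apply: mxop_inj => f; rewrite mxop_mul.
  apply/esym/eqP; rewrite -subr_eq0 -raddfB /=; apply/eqP.
  have [b' b'P] := adjoint_op _ _ b.
  apply: (ip_ext (H := ipn k)) => z; rewrite ip0l ipC -b'P ipC qort//.
  apply: (ip_ext (H := ipn n)) => u; rewrite adj b'P -mxop_mul ab mxop0 ip0r mulr0 ip0l//.
- apply/eqP; rewrite -subr_eq0; apply/eqP.
  have : n%:R - mxdim (complpow a a' k) - (m%:R - mxdim (complpow a' a k)) @[k --> \oo]
      --> n%:R - mxdim p - (m%:R - mxdim q).
    by apply: cvgB; apply: cvgB => //; exact: cvg_cst.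
  under eq_fun do rewrite mxdim_complpow subrr.
  move=> h; have := cvg_lim (@Rhausdorff R) h => <-.
  exact: lim_cst.
Qed.
End Rank.

(** * Dimension of modules over the von Neumann algebra *)
Section MatrixDimension.
Context (R : realType) (G : groupType).
Local Notation A := (vnalg R G)^c.

Lemma mulmx_rowP m n k (b : 'M[A]_m) (t : 'M[A]_(m, n)) :
  (forall v : 'rV_m, v *m b = v -> v *m t = 0 -> v = 0) ->
  forall v : 'M_(k, m), v *m b = v -> v *m t = 0 -> v = 0.
Proof.
move=> inj v vb vt; apply/row_matrixP => i; rewrite row0.
by apply: inj; rewrite -row_mul ?vb ?vt ?row0.
Qed.

(** An idempotent and the orthogonal projection with the same image have equal
    trace, and the trace of the projection is nonnegative. *)
Lemma mxdim_idem_ge0 n (e : 'M[A]_n) : e *m e = e -> 0 <= mxdim e.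
Proof.
move=> ee; have [p [q [[pe ker] _ p0 _]]] := rank_theorem (1%:M - e).
have ep : e *m p = e by apply: ker; rewrite mulmxBr mulmx1 ee subrr.
have pp : p *m e = p.
  by apply/esym/eqP; rewrite -subr_eq0 -{1}(mulmx1 p) -mulmxBr pe.
by rewrite -ep mxdim_mulC pp.
Qed.

(** Dimension is monotone: if v |-> vt is injective on the image of b, the rank of
    bt is the full dimension of b, and the difference of the dimensions of a and
    b is the trace of the idempotent aq, with q the cokernel of bt. *)
Lemma mxdim_inj m n (a : 'M[A]_n) (b : 'M[A]_m) (t : 'M[A]_(m, n)) :
  a *m a = a -> b *m b = b -> t *m a = t ->
  (forall v : 'rV_m, v *m b = v -> v *m t = 0 -> v = 0) ->
  mxdim b <= mxdim a.
Proof.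
move=> aa bb ta inj.
have [p [q [[pt ker] [tq coker] _ rk]]] := rank_theorem (b *m t).
have cb : (1%:M - b) *m p = 1%:M - b.
  by apply: ker; rewrite mulmxA mulmxBl mul1mx bb subrr mul0mx.
have pb : p *m b = 0.
  by apply: (mulmx_rowP inj); rewrite -mulmxA ?bb.
have dp : mxdim p = m%:R - mxdim b.
  have := congr1 (@mxdim R G m) cb.
  by rewrite mulmxBl mul1mx !mxdimB (mxdim_mulC b) pb mxdim0 subr0 mxdim1.
have qa : q *m (1%:M - a) = 1%:M - a.
  by apply: coker; rewrite -mulmxA mulmxBr mulmx1 ta subrr mulmx0.
have dq : mxdim q = mxdim (a *m q) + n%:R - mxdim a.
  have := congr1 (@mxdim R G n) qa.
  by rewrite mulmxBr mulmx1 !mxdimB (mxdim_mulC q) mxdim1; lra.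
have qq : q *m q = q by exact: coker.
have qaE : q *m a = q - (1%:M - a) by rewrite -qa mulmxBr mulmx1 subKr.
have aqa : a *m q *m a = a *m q.
  by rewrite -mulmxA qaE mulmxBr mulmxBr mulmx1 aa subrr subr0.
have aq0 : 0 <= mxdim (a *m q).
  by apply: mxdim_idem_ge0; rewrite mulmxA aqa -mulmxA qq.
by move: rk; rewrite dp dq; lra.
Qed.
End MatrixDimension.

Section ModuleDimension.
Context (R : realType) (G : groupType).
Local Notation A := (vnalg R G)^c.
Implicit Types M Z : lmodType A.

(** phi identifies the image of the idempotent a with M. *)
Record presents M n (a : 'M[A]_n) (phi : {linear 'rV[A]_n -> M}) : Prop := Presents {
  pres_idem : a *m a = a;
  pres_inj : forall v, v *m a = v -> phi v = 0 -> v = 0;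
  pres_surj : forall z, exists v, v *m a = v /\ phi v = z }.

Definition is_fgproj M := exists n (a : 'M[A]_n) phi, @presents M n a phi.

Lemma lift_rows (W : lmodType A) n (a : 'M[A]_n) (phi : {linear 'rV[A]_n -> W}) m
    (f : {linear 'rV[A]_m -> W}) :
  (forall i, exists s, s *m a = s /\ phi s = f (delta_mx 0 i)) ->
  exists t : 'M[A]_(m, n), t *m a = t /\ forall v, phi (v *m t) = f v.
Proof.
move=> /choice[s sP]; exists (\matrix_i s i); split.
  by apply/row_matrixP => i; rewrite row_mul !rowK (sP i).1.
move=> v; rewrite mulmx_sum_row [in RHS](row_sum_delta v) !linear_sum.
by apply: eq_bigr => i _; rewrite !linearZ_LR rowK (sP i).2.
Qed.

Lemma vndim_ge M n (a : 'M[A]_n) (phi : {linear 'rV[A]_n -> M}) : a *m a = a ->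
  (forall v, v *m a = v -> phi v = 0 -> v = 0) -> ((mxdim a)%:E <= vndim M)%E.
Proof.
move=> aa inj; apply: ereal_sup_ubound => /=.
by exists (phi @` [set v | v *m a = v]), n, a; split => //; split => //; exists phi.
Qed.

Lemma vndim_le M (d : \bar R) :
  (forall n (a : 'M[A]_n) (phi : {linear 'rV[A]_n -> M}), a *m a = a ->
    (forall v, v *m a = v -> phi v = 0 -> v = 0) -> ((mxdim a)%:E <= d)%E) ->
  (vndim M <= d)%E.
Proof.
move=> h; apply: ge_ereal_sup => _ /= [P [n [a [[aa [phi [inj _]]] ->]]]].
exact: h inj.
Qed.

Lemma vndim_ge0 M : (0 <= vndim M)%E.
Proof.
pose z : {linear 'rV[A]_0 -> M} := \0.
have := @vndim_ge M 0 0 z; rewrite mxdim0; apply; first by rewrite mulmx0.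
by move=> v _ _; apply/rowP => -[].
Qed.

(** The supremum that defines the dimension of a f.g. projective module is attained
    by the module itself, by [mxdim_inj]. *)
Lemma vndim_presents M n (a : 'M[A]_n) phi :
  @presents M n a phi -> vndim M = (mxdim a)%:E.
Proof.
case=> aa inj surj; apply/eqP; rewrite eq_le (vndim_ge aa inj) andbT.
apply: vndim_le => m b psi bb injb.
have [t [ta tP]] := @lift_rows M n a phi m psi (fun i => surj _).
rewrite lee_fin; apply: (mxdim_inj aa bb ta) => v vb vt.
by apply: injb => //; rewrite -tP vt raddf0.
Qed.

Lemma vndim_mono M M' (f : {linear M -> M'}) : injective f -> (vndim M <= vndim M')%E.
Proof.
move=> f_inj; apply: vndim_le => n a phi aa inj.
pose psi : {linear 'rV[A]_n -> M'} := f \o phi.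
apply: (vndim_ge (phi := psi)) => // v va fv; apply: inj => //.
by apply: f_inj; rewrite raddf0.
Qed.

(** For Z projective and X the image of t, where m - tr p is the rank of t: the
    quotient by the closure of X is the image of aq, a projective summand of Z
    on which Z -> Z/X restricts to an injection, which gives one inequality.
    Conversely a projective submodule Q of Z/X lifts to Z, and together with
    the complement of ker t it embeds into Z, so that dim Q + rank t <= dim Z. *)
Lemma vndim_quot Z n (a : 'M[A]_n) phi m (t : 'M[A]_(m, n)) (p : 'M[A]_m) (X : set Z) :
  @presents Z n a phi -> t *m a = t -> p *m t = 0 ->
  (forall k (v : 'M_(k, m)), v *m t = 0 -> v *m p = v) ->
  (forall z, X z <-> exists w, z = phi (w *m t)) ->
  vndim (quotmod X) = (mxdim a - (m%:R - mxdim p))%:E.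
Proof.
case=> aa inj surj ta pt ker XP.
have spX z : spanned X z -> X z.
  elim=> [|c x v Xx _ Xv]; first by apply/XP; exists 0; rewrite mul0mx raddf0.
  move/XP: Xx => [w ->]; move/XP: Xv => [w' ->]; apply/XP.
  by exists (c *: w + w'); rewrite mulmxDl -scalemxAl linearP.
have qX z : qpi X z = 0 <-> X z.
  split=> [|Xz].
    rewrite -(raddf0 (qpi X)) => /qpiP; rewrite subr0 => /spannedP; exact: spX.
  by rewrite -(raddf0 (qpi X)); apply/qpiP; rewrite subr0; apply/spannedP/spanned_gen.
have [p' [q [[p't ker'] [tq coker] p0 rk]]] := rank_theorem t.
have pp' : p *m p' = p by exact: ker'.
have p'p : p' *m p = p' by exact: ker.
have dp : mxdim p = mxdim p' by rewrite -pp' mxdim_mulC p'p.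
have qq : q *m q = q by exact: coker.
have qa : q *m (1%:M - a) = 1%:M - a.
  by apply: coker; rewrite mulmxBr mulmx1 ta subrr.
have qaE : q *m a = q - (1%:M - a) by rewrite -qa mulmxBr mulmx1 subKr.
have aqa : a *m q *m a = a *m q.
  by rewrite -mulmxA qaE mulmxBr mulmxBr mulmx1 aa subrr subr0.
have dq : mxdim (a *m q) = mxdim a - (m%:R - mxdim p).
  have := congr1 (@mxdim R G n) qa.
  by move: rk; rewrite mulmxBr mulmx1 !mxdimB (mxdim_mulC q) mxdim1 dp; lra.
apply/eqP; rewrite eq_le; apply/andP; split; last first.
  rewrite -dq.
  pose psi : {linear 'rV[A]_n -> quotmod X} := qpi X \o phi.
  apply: (vndim_ge (phi := psi)) => [|v vaq /= /qX/XP[w]].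
    by rewrite mulmxA aqa -mulmxA qq.
  have va : v *m a = v by rewrite -vaq -mulmxA aqa.
  have vq : v *m q = v by rewrite -{2}vaq mulmxA va.
  move=> e; have : v - w *m t = 0.
    by apply: inj; rewrite ?raddfB/= ?e ?subrr// mulmxBl va -mulmxA ta.
  by move=> /eqP; rewrite subr_eq0 => /eqP vw; rewrite -vq vw -mulmxA tq mulmx0.
apply: vndim_le => l c psi cc injc.
have psi_lift i : exists s, s *m a = s /\ (qpi X \o phi) s = psi (delta_mx 0 i).
  have [z ->] := qpi_surj (psi (delta_mx 0 i)).
  by have [s [sa <-]] := surj z; exists s.
have [s [sa sP]] := lift_rows psi_lift.
rewrite lee_fin.
(* s lifts the submodule and 1 - p restricts t to a complement of its kernel. *)
pose T : 'M_(l + m, n) := col_mx s t.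
pose b : 'M_(l + m) := block_mx c 0 0 (1%:M - p).
have pp : p *m p = p by exact: ker.
have bb : b *m b = b.
  rewrite /b mulmx_block !mulmx0 !mul0mx !addr0 !add0r cc.
  by rewrite mulmxBl mul1mx mulmxBr mulmx1 pp subrr subr0.
have Ta : T *m a = T by rewrite mul_col_mx sa ta.
have : mxdim b <= mxdim a.
  apply: (mxdim_inj aa bb Ta) => v; rewrite -(hsubmxK v).
  set x := lsubmx v; set y := rsubmx v.
  rewrite /b mul_row_block !mulmx0 addr0 add0r => /eq_row_mx[xc yp].
  rewrite mul_row_col => xy0.
  have yp0 : y *m p = 0.
    move: yp; rewrite mulmxBr mulmx1 => /eqP.
    by rewrite subr_eq addrC -subr_eq subrr eq_sym => /eqP.
  have x0 : x = 0.
    apply: injc => //; rewrite -sP /=; apply/qX/XP; exists (- y).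
    suff -> : x *m s = - y *m t by [].
    by apply/eqP; rewrite mulNmx -addr_eq0 xy0.
  have : y *m t = 0 by move: xy0; rewrite x0 mul0mx add0r.
  by move=> /ker; rewrite yp0 x0 => <-; rewrite row_mx0.
have -> : mxdim b = mxdim c + (m%:R - mxdim p).
  rewrite -(@mxdim1 R G m) -mxdimB /mxdim big_split_ord raddfD /=.
  by congr (complex.Re _ + complex.Re _); apply: eq_bigr => i _;
    rewrite /b ?block_mxEul ?block_mxEdr.
by lra.
Qed.
End ModuleDimension.

(** * Homology of complexes of finitely generated projective modules *)
Section EulerCharacteristic.
Context (R : realType) (G : groupType).
Local Notation A := (vnalg R G)^c.
Implicit Types M : lmodType A.

Definition rdim M : R := fine (vndim M).

Lemma rdim_presents M n (a : 'M[A]_n) phi : presents (M := M) a phi -> rdim M = mxdim a.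
Proof. by move=> h; rewrite /rdim (vndim_presents h). Qed.

Lemma vndim_rdim M : is_fgproj M -> vndim M = (rdim M)%:E.
Proof. by move=> [n [a [phi h]]]; rewrite (rdim_presents h) (vndim_presents h). Qed.

Lemma cycle_val_is_linear (D : chain_complex A) n : linear (@cycle_val A D n).
Proof. by []. Qed.
HB.instance Definition _ (D : chain_complex A) n :=
  GRing.isLinear.Build A (cycle D n) (ch D n) _ (@cycle_val A D n) (@cycle_val_is_linear D n).

Lemma cycle_inj (D : chain_complex A) n (y z : cycle D n) :
  cycle_val y = cycle_val z -> y = z.
Proof. exact: val_inj. Qed.

Lemma corestrict (D : chain_complex A) n k (f : {linear 'rV[A]_k -> ch D n}) :
  (forall v, f v \in @cyclep A D n) ->
  exists g : {linear 'rV[A]_k -> cycle D n}, forall v, cycle_val (g v) = f v.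
Proof.
move=> fc; pose g v := Cycle (fc v).
have lg : linear g by move=> c u v; apply: cycle_inj; rewrite linearP /= linearP.
pose g' : {linear 'rV[A]_k -> cycle D n} :=
  HB.pack g (GRing.isLinear.Build A 'rV[A]_k (cycle D n) _ g lg).
by exists g'.
Qed.

Lemma bd_cycle (D : chain_complex A) n z : bd D n z \in @cyclep A D n.
Proof. by case: n z => // n z; apply/eqP; exact: bd_bd. Qed.

Lemma cycle0_is_fgproj (D : chain_complex A) : is_fgproj (ch D 0) ->
  is_fgproj (cycle D 0) /\ rdim (cycle D 0) = rdim (ch D 0).
Proof.
move=> [n [a [phi h]]]; have [aa inj surj] := h.
have [//|g gP] := @corestrict D 0 n phi.
suff h' : presents a g.
  by split; [exists n, a, g|rewrite (rdim_presents h) (rdim_presents h')].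
split => // [v va gv|z].
  by apply: inj => //; rewrite -gP gv raddf0.
by have [v [va vz]] := surj (cycle_val z); exists v; split => //; apply: cycle_inj; rewrite gP.
Qed.

(** Let t be the matrix of the boundary C_(n+1) -> Z_n and p the idempotent of its
    kernel.  Cycles of degree n+1 are the image of the idempotent pb, and
    [vndim_quot] gives dim H_n = dim Z_n - rank t. *)
Lemma cycleS_is_fgproj (D : chain_complex A) n :
  is_fgproj (cycle D n) -> is_fgproj (ch D n.+1) ->
  is_fgproj (cycle D n.+1) /\
  vndim (homology D n) =
    (rdim (cycle D n) - (rdim (ch D n.+1) - rdim (cycle D n.+1)))%:E.
Proof.
move=> [k [e [phi h]]] [m [b [psi h']]].
have [ee inj surj] := h; have [bb inj' surj'] := h'.
pose f : {linear 'rV[A]_m -> ch D n} := bd D n \o psi \o mulmxr b.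
have fc i : exists s, s *m e = s /\ (@cycle_val A D n \o phi) s = f (delta_mx 0 i).
  have fc : f (delta_mx 0 i) \in @cyclep A D n.
    exact: bd_cycle.
  by have [s [se sP]] := surj (Cycle fc); exists s; rewrite /= sP.
have [t [te tP]] := lift_rows fc.
have [p [q [[pt ker] _ _ _]]] := rank_theorem t.
have pp : p *m p = p by exact: ker.
have tz v : v *m t = 0 <-> bd D n (psi (v *m b)) = 0.
  rewrite -[bd _ _ _]/(f v) -tP /=; split=> [->|vt]; first by rewrite !raddf0.
  apply: inj; first by rewrite -mulmxA te.
  by apply: cycle_inj; rewrite vt.
have cbt : (1%:M - b) *m t = 0.
  apply/row_matrixP => i; rewrite row_mul row0; apply/tz.
  by rewrite -row_mul mulmxBl mul1mx bb subrr row0 !raddf0.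
(* The kernel of t contains that of b, hence p b is idempotent. *)
have cbp : (1%:M - b) *m p = 1%:M - b by exact: ker.
have btE : b *m t = t.
  by apply/esym/eqP; rewrite -subr_eq0 -{1}(mul1mx t) -mulmxBl cbt.
have pbp : p *m b *m p = p *m b by apply: ker; rewrite -mulmxA btE.
have pbpb : p *m b *m (p *m b) = p *m b by rewrite mulmxA pbp -mulmxA bb.
have dpb : mxdim (p *m b) = mxdim p - m%:R + mxdim b.
  have := congr1 (@mxdim R G m) cbp.
  by rewrite mulmxBl mul1mx !mxdimB (mxdim_mulC b) mxdim1; lra.
have [|g gP] := @corestrict D n.+1 m (psi \o mulmxr (p *m b)).
  move=> v; apply/eqP; rewrite /= mulmxA; apply/tz.
  by rewrite -mulmxA pt mulmx0.
have hS : presents (p *m b) g.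
  split => // [v vpb gv|z].
    apply: inj'; first by rewrite -vpb -!mulmxA bb.
    by rewrite -vpb -[psi _]/((psi \o mulmxr (p *m b)) v) -gP gv raddf0.
  have [v [vb vz]] := surj' (cycle_val z).
  have vt : v *m t = 0 by apply/tz; rewrite vb vz; exact/eqP/(cycleP z).
  exists v; have vpb : v *m (p *m b) = v by rewrite mulmxA ker.
  by split => //; apply: cycle_inj; rewrite gP /= vpb.
split; first by exists m, (p *m b), g.
rewrite /homology (vndim_quot h te pt (X := @boundary A D n) ker); last first.
  move=> z; split=> [[c cz]|[w ->]].
    have [w [wb wc]] := surj' c; exists w; apply: cycle_inj.
    by rewrite -cz -wc -[RHS]/((@cycle_val A D n \o phi) (w *m t)) tP /= wb.
  by exists (psi (w *m b)); rewrite -[RHS]/((@cycle_val A D n \o phi) (w *m t)) tP.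
rewrite (rdim_presents h) (rdim_presents h') (rdim_presents hS) dpb.
by congr (_%:E); ring.
Qed.

(** z n is the dimension of the module of cycles; the alternating sum of these
    homology dimensions telescopes. *)
Lemma vndim_homology (D : chain_complex A) : (forall n, is_fgproj (ch D n)) ->
  exists z : nat -> R, [/\ z 0%N = rdim (ch D 0), forall n, 0 <= z n <= rdim (ch D n)
    & forall n, vndim (homology D n) = (z n - rdim (ch D n.+1) + z n.+1)%:E].
Proof.
move=> fD.
have fZ n : is_fgproj (cycle D n).
  elim: n => [|n IH]; first exact: (cycle0_is_fgproj (fD 0%N)).1.
  exact: (cycleS_is_fgproj IH (fD n.+1)).1.
exists (fun n => rdim (cycle D n)); split=> [|n|n].
- exact: (cycle0_is_fgproj (fD 0%N)).2.
- apply/andP; split; first by rewrite -lee_fin -vndim_rdim// vndim_ge0.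
  rewrite -lee_fin -!vndim_rdim//.
  by apply: (vndim_mono (f := @cycle_val A D n)); exact: cycle_inj.
- by rewrite (cycleS_is_fgproj (fZ n) (fD n.+1)).2 opprB addrA addrAC.
Qed.

Lemma retract_presents M n (al : {linear M -> 'rV[A]_n}) (be : {linear 'rV[A]_n -> M}) :
  cancel al be -> presents (lin1_mx (al \o be)) be.
Proof.
move=> K; have E v : v *m lin1_mx (al \o be) = al (be v) by rewrite mul_rV_lin1.
split=> [|v va bv|z].
- apply/row_matrixP => i; rewrite row_mul E rowE E K.
  by rewrite -E -rowE.
- by rewrite -va E bv raddf0.
- by exists (al z); rewrite E K.
Qed.

Lemma is_fgproj_retract M : is_fgproj M -> exists n (al : {linear M -> 'rV[A]_n})
  (be : {linear 'rV[A]_n -> M}), cancel al be.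
Proof.
move=> [n [a [phi [aa inj surj]]]].
have /choice[al alP] := surj.
have lal : linear al.
  move=> c u v; apply/eqP; rewrite -subr_eq0; apply/eqP/inj.
    by rewrite mulmxBl mulmxDl -scalemxAl !(alP _).1.
  by rewrite linearB linearD linearZ_LR /= !(alP _).2 subrr.
pose al' : {linear M -> 'rV[A]_n} :=
  HB.pack al (GRing.isLinear.Build A M 'rV[A]_n _ al lal).
exists n, al', phi.
by move=> z; exact: (alP z).2.
Qed.

(** Transported to one matrix ring, the idempotents of the two summands add up to
    that of M, and the trace is additive. *)
Lemma rdim_split (M0 M M2 : lmodType A) (i0 : {linear M0 -> M}) (r0 : {linear M -> M0})
    (i2 : {linear M2 -> M}) (r2 : {linear M -> M2}) :
  cancel i0 r0 -> cancel i2 r2 -> (forall m, i0 (r0 m) + i2 (r2 m) = m) ->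
  is_fgproj M -> rdim M = rdim M0 + rdim M2.
Proof.
move=> K0 K2 E /is_fgproj_retract[n [al [be K]]].
have c0 : cancel (al \o i0) (r0 \o be) by move=> z /=; rewrite K K0.
have c2 : cancel (al \o i2) (r2 \o be) by move=> z /=; rewrite K K2.
rewrite (rdim_presents (retract_presents K)).
rewrite (rdim_presents (retract_presents c0)) (rdim_presents (retract_presents c2)).
rewrite -mxdimD; congr mxdim; apply/row_matrixP => i.
rewrite raddfD /= !rowE !mul_rV_lin1 /=.
by rewrite -raddfD E.
Qed.

Lemma rdim0 M : (forall z : M, z = 0) -> rdim M = 0.
Proof.
move=> z; have h : presents (M := M) (0 : 'M[A]_0) \0.
  split=> [|v _ _|y]; first by rewrite mulmx0.
    by apply/rowP => -[].
  by exists 0; rewrite mulmx0 (z y) (z (_ _)).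
by rewrite (rdim_presents h) mxdim0.
Qed.
End EulerCharacteristic.

(** * The splitting functor tensored with the von Neumann algebra *)
Section CMaps.
Context (R : realType) (Gam : category).
Local Notation cmodule := (cmodule R Gam).
Implicit Types M N L : cmodule.

Definition cm_id M : cmap M M := @CMap R Gam M M (fun x => idfun) (fun x y u m => erefl).

Program Definition cm_comp M N L (g : cmap N L) (f : cmap M N) : cmap M L :=
  @CMap R Gam M L (fun x => g x \o f x) _.
Next Obligation. by move=> M N L g f x y u m /=; rewrite !cmapE. Qed.

Program Definition cm_add M N (f g : cmap M N) : cmap M N :=
  @CMap R Gam M N (fun x => f x \+ g x) _.
Next Obligation. by move=> M N f g x y u m /=; rewrite !cmapE raddfD. Qed.

Program Definition cm_sub M N (f g : cmap M N) : cmap M N :=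
  @CMap R Gam M N (fun x => f x \- g x) _.
Next Obligation. by move=> M N f g x y u m /=; rewrite !cmapE raddfB. Qed.

Lemma cm_inv M N (f : cmap M N) : (forall x, bijective (f x)) ->
  exists g : cmap N M, forall x, cancel (f x) (g x) /\ cancel (g x) (f x).
Proof.
move=> bf.
have ex x : exists g : {linear N x -> M x}, cancel (f x) g /\ cancel g (f x).
  have [g fg gf] := bf x.
  have lg : linear g by move=> a u v; apply: (can_inj fg); rewrite linearP !gf.
  pose g' : {linear N x -> M x} :=
    HB.pack g (GRing.isLinear.Build R[i] (N x) (M x) _ g lg).
  by exists g'.
pose g x := projT1 (cid (ex x)).
have gP x : cancel (f x) (g x) /\ cancel (g x) (f x) := projT2 (cid (ex x)).
have gE x y (u : hom x y) (n : N y) : g x (act N u n) = act M u (g y n).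
  by apply: (can_inj (gP x).1); rewrite cmapE (gP x).2 (gP y).2.
by exists (CMap gE).
Qed.

Lemma summand_retract M F : direct_summand M F ->
  exists (i : cmap M F) (r : cmap F M), forall x, cancel (i x) (r x).
Proof.
move=> [N [f /cm_inv[g fg]]].
have lin x : linear (fun m : M x => (m, 0) : cm_sum M N x).
  by move=> a u v; congr (_, _); rewrite /= scaler0 addr0.
pose i1 x : {linear M x -> cm_sum M N x} :=
  HB.pack (fun m : M x => (m, 0) : cm_sum M N x)
    (GRing.isLinear.Build R[i] (M x) (cm_sum M N x) _ _ (lin x)).
have i1E x y (u : hom x y) (m : M y) : i1 x (act M u m) = act (cm_sum M N) u (i1 y m).
  by congr (_, _); rewrite raddf0.
have lin2 x : linear (fun p : cm_sum M N x => p.1 : M x) by [].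
pose r1 x : {linear cm_sum M N x -> M x} :=
  HB.pack (fun p : cm_sum M N x => p.1 : M x)
    (GRing.isLinear.Build R[i] (cm_sum M N x) (M x) _ _ (lin2 x)).
have r1E x y (u : hom x y) (m : cm_sum M N y) : r1 x (act (cm_sum M N) u m) = act M u (r1 y m).
  by [].
exists (cm_comp f (CMap i1E)), (cm_comp (CMap r1E) g) => x m /=.
by rewrite (fg x).1.
Qed.
End CMaps.

Section VnFunctor.
Context (R : realType) (Gam : category) (x : Gam).
Local Notation cmodule := (cmodule R Gam).
Local Notation Nc := (vnalg R (aut x))^c.
Implicit Types M N L : cmodule.

(** The class of m (x) 1; these elements generate the module. *)
Definition vngen M (m : M x) : vnsplitting x M :=
  qpi _ (<< (1 : Nc) *g qpi (@singular R Gam x M) (m : cm_at x M) >>).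

Lemma vnmap_gen M N (f : cmap M N) m : vnsplitting_map x f (vngen m) = vngen (f x m).
Proof. by rewrite /vngen /vnsplitting_map /tens_map quotmap_pi freeg_mapU quotmap_pi. Qed.

Lemma vn_ext M (W : lmodType Nc) (F F' : {linear vnsplitting x M -> W}) :
  (forall m, F (vngen m) = F' (vngen m)) -> F =1 F'.
Proof.
move=> FF z; have [w ->] := qpi_surj z.
pose h (K : {linear vnsplitting x M -> W}) :
  {linear {freeg (splitting x M) / Nc} -> W} := K \o qpi _.
apply: (freeg_linext (f := h F) (g := h F')) => q.
by have [m ->] := qpi_surj q; exact: FF.
Qed.

Lemma vngenD M m m' : vngen (m + m' : M x) = vngen m + vngen m'.
Proof.
rewrite /vngen -[RHS]raddfD; apply/qpiP/spannedP/spanned_gen.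
rewrite [X in << _ *g X >>](raddfD (qpi (@singular R Gam x M))); exact: tens_relD.
Qed.

Lemma vngen_scale M (a : gring R (aut x)) (m : M x) :
  vngen (at_scale (M := M) a m : M x) = (gring_vn a : Nc) *: vngen m.
Proof.
rewrite /vngen -linearZ_LR -freegUZ; apply/qpiP/spannedP/spanned_gen.
rewrite -[at_scale a m]/((a : (gring R (aut x))^c) *: (m : cm_at x M)) linearZ_LR.
exact: tens_relZ.
Qed.

Lemma vnmapP M N (h f g : cmap M N) : (forall m, h x m = f x m + g x m) ->
  forall z, vnsplitting_map x h z = vnsplitting_map x f z + vnsplitting_map x g z.
Proof.
move=> hfg; apply: (vn_ext (F := vnsplitting_map x h)
  (F' := vnsplitting_map x f \+ vnsplitting_map x g)) => m.
rewrite -[RHS]/(vnsplitting_map x f (vngen m) + vnsplitting_map x g (vngen m)).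
by rewrite !vnmap_gen hfg vngenD.
Qed.

Lemma vnmap_comp M N L (g : cmap N L) (f : cmap M N) z :
  vnsplitting_map x (cm_comp g f) z = vnsplitting_map x g (vnsplitting_map x f z).
Proof.
apply: (vn_ext (F := vnsplitting_map x (cm_comp g f))
  (F' := vnsplitting_map x g \o vnsplitting_map x f)) => m.
rewrite -[RHS]/(vnsplitting_map x g (vnsplitting_map x f (vngen m))).
by rewrite !vnmap_gen.
Qed.

Lemma vnmap_id M (f : cmap M M) : (forall m, f x m = m) ->
  forall z, vnsplitting_map x f z = z.
Proof.
move=> fE; apply: (vn_ext (F := vnsplitting_map x f) (F' := idfun)) => m.
by rewrite vnmap_gen fE.
Qed.

Lemma vnmap_eq M N (f g : cmap M N) : (forall m, f x m = g x m) ->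
  vnsplitting_map x f =1 vnsplitting_map x g.
Proof.
move=> fg; apply: (vn_ext (F := vnsplitting_map x f) (F' := vnsplitting_map x g)) => m.
by rewrite !vnmap_gen fg.
Qed.

Lemma vnmap_cancel M N (f : cmap M N) (g : cmap N M) :
  cancel (f x) (g x) -> cancel (vnsplitting_map x f) (vnsplitting_map x g).
Proof.
move=> fg z; rewrite -vnmap_comp; apply: vnmap_id => m; exact: fg.
Qed.

Lemma vngen_zero M : (forall m : M x, vngen m = 0) -> forall z : vnsplitting x M, z = 0.
Proof. by move=> g0; apply: (vn_ext (F := idfun) (F' := \0)) => m; exact: g0. Qed.
End VnFunctor.

(** * The splitting functor on free modules *)
Lemma freeg_ind (S : nzRingType) (K : choiceType) (P : {freeg K / S} -> Prop) : P 0 ->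
  (forall c k a, P a -> P (c *: << 1 *g k >> + a)) -> forall a, P a.
Proof.
move=> P0 PD a; rewrite -[a]freeg_sumE.
elim: (dom _) => [|k s IH]; first by rewrite big_nil.
by rewrite big_cons freegUZ; exact: PD.
Qed.

(** Stated for a function that is only semilinear, through sc: the coordinates
    below go from modules over C[x] to modules over N. *)
Lemma quot_lift (S : nzRingType) (V : lmodType S) (X : set V) (T : zmodType)
    (f : {additive V -> T}) (sc : S -> T -> T) :
  (forall a v, f (a *: v) = sc a (f v)) -> (forall a, sc a 0 = 0) ->
  (forall v, X v -> f v = 0) ->
  exists F : quotmod X -> T, forall v, F (qpi X v) = f v.
Proof.
move=> fZ sc0 fX.
have sp0 v : spanned X v -> f v = 0.
  by elim=> [|a y w Xy _ IH]; rewrite ?raddf0// raddfD /= IH addr0 fZ fX.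
have /choice[F FP] q : exists t, forall v, q = qpi X v -> t = f v.
  have [w ->] := qpi_surj q; exists (f w) => v /qpiP/spannedP/sp0/eqP.
  by rewrite raddfB subr_eq0 => /eqP.
by exists F => v; exact: FP.
Qed.

Section FreeSplitting.
Context (R : realType) (Gam : category) (x : Gam).
Context (Gam_df : directly_finite Gam) (n : nat) (o : 'I_n -> Gam).
Local Notation C := R[i].
Local Notation N := (vnalg R (aut x)).
Local Notation Nc := (N^c).
Local Notation F := (cm_free R o).

Definition fgen (y : Gam) i (h : hom y (o i)) : F y :=
  << 1 *g (existT _ i h : free_basis o y) >>.

Lemma act_fgen y z (u : hom y z) i (h : hom z (o i)) : act F u (fgen h) = fgen (cmp h u).
Proof. exact: free_linU. Qed.

Lemma vngen0 (M : cmodule R Gam) : vngen (0 : M x) = 0.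
Proof. by apply: (addrI (vngen 0)); rewrite -vngenD !addr0. Qed.

Lemma vngen_singular (M : cmodule R Gam) y (u : hom x y) (m : M y) :
  ~ is_iso u -> vngen (act M u m) = 0.
Proof.
move=> nu; rewrite -(vngen0 M); congr (qpi _ << _ *g _ >>).
by apply/qpiP; rewrite subr0; apply/spannedP/spanned_gen; exact: Singular.
Qed.

Lemma vngen_fgen_noniso i (h : hom x (o i)) : ~ is_iso h -> vngen (fgen h) = 0.
Proof.
by move=> nh; rewrite -[h]cmp1l -act_fgen; exact: vngen_singular.
Qed.

(** If u : x -> o i is an isomorphism, every isomorphism h : x -> o i is u g for
    one automorphism g of x.  The coordinate of h is the translation by g, the
    basis element b is the class of u, and non-isomorphisms have coordinate 0
    and class 0.  If there is no isomorphism, phi and b vanish. *)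
Lemma coordinate i : exists (phi : hom x (o i) -> N) (b : vnsplitting x F),
  [/\ forall h, ~ is_iso h -> phi h = 0,
      forall h g, phi (cmp h (aut_fun g)) = phi h * vn_ltrans R g
    & forall h, (phi h : Nc) *: b = vngen (fgen h)].
Proof.
have [[u [v [vu uv]]]|nu] := pselect (exists u : hom x (o i), is_iso u); last first.
  exists (fun=> 0), 0; split=> // [h g|h]; first by rewrite mul0r.
  by rewrite scaler0 vngen_fgen_noniso// => ih; apply: nu; exists h.
pose im h := exists g : aut x, cmp u (aut_fun g) = h.
pose phi h : N := if pselect (im h) is left e then vn_ltrans R (projT1 (cid e)) else 0.
have phiE g : phi (cmp u (aut_fun g)) = vn_ltrans R g.
  rewrite /phi; case: pselect => [e|[]]; last by exists g.
  case: cid => g' /= ug; congr (vn_ltrans R _); apply: aut_eq.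
  by rewrite -[LHS]cmp1l -vu -cmpA ug cmpA vu cmp1l.
have phi0 h : ~ im h -> phi h = 0 by rewrite /phi; case: pselect.
have im_iso h : is_iso h -> im h.
  move=> [w [wh hw]].
  have e1 : cmp (cmp w u) (cmp v h) = idc x by rewrite cmpA -(cmpA w) uv cmp1r.
  have e2 : cmp (cmp v h) (cmp w u) = idc x by rewrite cmpA -(cmpA v) hw cmp1r.
  by exists (Aut e1 e2); rewrite /= cmpA uv cmp1l.
exists phi, (vngen (fgen u)); split=> [h nh|h g|h].
- apply: phi0 => -[g e]; apply: nh; exists (cmp (aut_inv g) v); rewrite -e; split.
    by rewrite cmpA -(cmpA _ v) vu cmp1r aut_invl.
  by rewrite cmpA -(cmpA u) aut_invr cmp1r.
- have [[g' <-]|nh] := pselect (im h).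
    by rewrite phiE vn_ltransM -phiE -cmpA.
  rewrite (phi0 _ nh) mul0r phi0// => -[g' e]; apply: nh.
  exists (g' * g^-1)%g; rewrite /= [LHS]cmpA e -cmpA.
  by rewrite (aut_invr g) cmp1r.
- have [[g <-]|nh] := pselect (im h).
    by rewrite phiE -gring_vn_delta -vngen_scale at_scale_delta act_fgen.
  by rewrite phi0// scale0r vngen_fgen_noniso// => /im_iso.
Qed.

(** The coordinates of [coordinate] extend linearly to F(x).  They vanish on the
    singular part: h u with u not an isomorphism is not an isomorphism, because
    a left inverse of u would be two-sided by direct finiteness.  So they
    descend to the tensor product, and al followed by be fixes the generators. *)
Lemma vnfree_retract : exists (al : {linear vnsplitting x F -> 'rV[Nc]_n})
  (be : {linear 'rV[Nc]_n -> vnsplitting x F}), cancel al be.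
Proof.
pose phi i : hom x (o i) -> N := projT1 (cid (coordinate i)).
have /choice[b bP] i : exists b : vnsplitting x F,
  [/\ forall h, ~ is_iso h -> phi i h = 0,
      forall h g, phi i (cmp h (aut_fun g)) = phi i h * vn_ltrans R g
    & forall h, (phi i h : Nc) *: b = vngen (fgen h)] := projT2 (cid (coordinate i)).
pose c1 j : {linear F x -> N} := fglift (fun t : free_basis o x =>
  if projT1 t == j then phi (projT1 t) (projT2 t) else 0).
have c1E j i h : c1 j (fgen h) = if i == j then phi i h else 0.
  by rewrite [LHS]liftU scale1r.
have c1_scale j (a : gring R (aut x)) m :
    c1 j (at_scale (M := F) a m : F x) = c1 j m * gring_vn a.
  elim/gring_ind: a => [|k g a IH].
    by rewrite [at_scale _ _]at_scale0 gring_vn0 mulr0 raddf0.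
  rewrite at_scale_linear linearP /= IH gring_vn_is_linear mulrDr vn_scaler.
  congr (_ *: _ + _); rewrite at_scale_delta gring_vn_delta => {a IH}.
  elim/freeg_ind: m => [|c [i h] m IH]; first by rewrite !raddf0 mul0r.
  rewrite !linearP /= mulrDl IH vn_scalel; congr (_ *: _ + _).
  rewrite -[<< _ *g _ >>]/(fgen h) act_fgen !c1E; case: eqP => _; last by rewrite mul0r.
  by have [_ -> _] := bP i.
have c1_sing j z : singular (M := F) z -> c1 j z = 0.
  case=> y u m nu; elim/freeg_ind: m => [|c [i h] m IH]; first by rewrite !raddf0.
  rewrite !linearP /= IH addr0 -[<< _ *g _ >>]/(fgen h) act_fgen c1E.
  have [phi0 _ _] := bP i; rewrite phi0 ?if_same ?scaler0// => -[w [whu huw]].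
  by apply: nu; exists (cmp w h); split; [rewrite -cmpA|apply: Gam_df; rewrite -cmpA].
have /choice[al1 al1P] j : exists al1 : {linear vnsplitting x F -> Nc^o},
    forall m, al1 (vngen m) = c1 j m.
  pose c1a : {additive cm_at x F -> N} := c1 j.
  have [|a||c2 c2P] := @quot_lift _ _ (@singular R Gam x F) N c1a (fun a t => t * gring_vn a).
  - by move=> a m; exact: c1_scale.
  - by rewrite mul0r.
  - exact: c1_sing.
  pose c3 : {linear {freeg (splitting x F) / Nc} -> Nc^o} := fglift (c2 : splitting x F -> Nc^o).
  have c3E (k : Nc) q : c3 << k *g q >> = k *: (c2 q : Nc^o) by rewrite [LHS]liftU.
  have [||z|al alP] := @quot_lift _ _ (@tens_rel _ _ (@gring_vn R (aut x)) (splitting x F))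
    Nc^o c3 *:%R.
  - by move=> k w; exact: (linearZ_LR c3).
  - by move=> k; rewrite scaler0.
  - case=> [q q'|a q]; rewrite raddfB ?raddfD /= !c3E.
      have [m ->] := qpi_surj q; have [m' ->] := qpi_surj q'.
      have -> : c2 (qpi _ m + qpi _ m') = c1a m + c1a m'.
        by rewrite -[X in c2 X]raddfD c2P raddfD.
      rewrite !c2P !scale1r; rewrite -opprD; exact: subrr.
    have [m ->] := qpi_surj q.
    have -> : c2 (a *: qpi _ m) = c1a m * gring_vn a.
      by rewrite -[X in c2 X]linearZ_LR c2P; exact: c1_scale.
    rewrite !c2P !scale1r; exact: subrr.
  have lal : linear (al : vnsplitting x F -> Nc^o).
    move=> k y z; have [v ->] := qpi_surj y; have [w ->] := qpi_surj z.
    by rewrite -[X in al X]linearP !alP; exact: (linearP c3).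
  pose al' : {linear vnsplitting x F -> Nc^o} :=
    HB.pack (al : vnsplitting x F -> Nc^o)
     (GRing.isLinear.Build Nc (vnsplitting x F) Nc^o _ al lal).
  by exists al' => m; rewrite /= alP [LHS]c3E c2P scale1r.
have lal : linear (fun z => \row_j (al1 j z : Nc)).
  by move=> a y z; apply/rowP => j; rewrite !mxE linearP.
have lbe : linear (fun v : 'rV[Nc]_n => \sum_j v 0 j *: b j).
  move=> a v w; rewrite scaler_sumr -big_split; apply: eq_bigr => j _.
  by rewrite !mxE scalerDl scalerA.
pose al : {linear vnsplitting x F -> 'rV[Nc]_n} :=
  HB.pack (fun z => \row_j (al1 j z : Nc))
   (GRing.isLinear.Build Nc (vnsplitting x F) 'rV[Nc]_n _ _ lal).
pose be : {linear 'rV[Nc]_n -> vnsplitting x F} :=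
  HB.pack (fun v : 'rV[Nc]_n => \sum_j v 0 j *: b j)
   (GRing.isLinear.Build Nc 'rV[Nc]_n (vnsplitting x F) _ _ lbe).
have bealD u v : be (al (u + v)) = be (al u) + be (al v).
  by rewrite (linearD al) (linearD be).
have bealZ k u : be (al (k *: u)) = k *: be (al u).
  by rewrite (linearZ_LR al) (linearZ_LR be).
exists al, be; apply: (vn_ext (F := be \o al) (F' := idfun)) => m.
rewrite [RHS]/= -[LHS]/(be (al (vngen m))).
elim/freeg_ind: m => [|c [i h] m IH]; first by rewrite vngen0 !raddf0.
rewrite vngenD bealD IH; congr (_ + _).
rewrite (_ : c *: _ = at_scale (M := F) (c *: gdelta R 1%g) (fgen h) :> F x); last first.
  rewrite -[c *: gdelta R 1%g]addr0 at_scale_linear at_scale_delta at_scale0 addr0.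
  by rewrite act_id.
rewrite vngen_scale bealZ; congr (_ *: _).
have [_ _ bh] := bP i.
transitivity (\sum_j al1 j (vngen (fgen h)) *: b j).
  by apply: eq_bigr => j _; rewrite mxE.
rewrite (bigD1 i)//= al1P c1E eqxx bh big1 ?addr0// => j /negPf ji.
by rewrite al1P c1E eq_sym ji scale0r.
Qed.

Lemma vnfree_zero : (forall i, ~ exists u : hom x (o i), is_iso u) ->
  forall z : vnsplitting x F, z = 0.
Proof.
move=> no; apply: vngen_zero; elim/freeg_ind => [|c [i h] m IH]; first exact: vngen0.
rewrite vngenD IH addr0.
rewrite (_ : c *: _ = at_scale (M := F) (c *: gdelta R 1%g) (fgen h) :> F x); last first.
  rewrite -[c *: gdelta R 1%g]addr0 at_scale_linear at_scale_delta at_scale0 addr0.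
  by rewrite act_id.
rewrite vngen_scale vngen_fgen_noniso ?scaler0// => ih.
by apply: (no i); exists h.
Qed.
End FreeSplitting.

Section FgProjective.
Context (R : realType) (Gam : category) (Gam_df : directly_finite Gam).

Lemma vnsplitting_is_fgproj (M : cmodule R Gam) x : fg_projective M -> is_fgproj (vnsplitting x M).
Proof.
move=> [n [o /summand_retract[i [r K]]]].
have [al [be K']] := vnfree_retract R x Gam_df o.
have K'' : cancel (al \o vnsplitting_map x i) (vnsplitting_map x r \o be).
  move=> z; rewrite -[LHS]/(vnsplitting_map x r (be (al (vnsplitting_map x i z)))).
  by rewrite K'; exact: vnmap_cancel.
have h := retract_presents K''.
by exists n, (lin1_mx ((al \o vnsplitting_map x i) \o (vnsplitting_map x r \o be))),
  (vnsplitting_map x r \o be).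
Qed.

Lemma vnsplitting_support (M : cmodule R Gam) : fg_projective M ->
  exists s : seq (isocl Gam), forall x, iso_class x \notin s ->
    rdim (vnsplitting x M) = 0.
Proof.
move=> [n [o /summand_retract[i [r K]]]].
exists [seq iso_class (o i) | i <- enum 'I_n] => x xs; apply: rdim0 => z.
have z0 : vnsplitting_map x i z = 0.
  apply: vnfree_zero => j [u iu]; move/negP: xs; apply.
  have -> : iso_class x = iso_class (o j) by apply/iso_classP; exists u.
  by apply: map_f; rewrite mem_enum.
have := vnmap_cancel (K x) z; rewrite z0 => <-; exact: raddf0.
Qed.
End FgProjective.

(** * Projective resolutions up to chain homotopy *)
Section Lifting.
Context (R : realType) (Gam : category).
Local Notation cmodule := (cmodule R Gam).

Lemma free_lift (I : Type) (o : I -> Gam) (A B : cmodule) (f : cmap A B)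
    (h : cmap (cm_free R o) B) :
  (forall y m, exists a, f y a = h y m) ->
  exists k : cmap (cm_free R o) A, forall y m, f y (k y m) = h y m.
Proof.
move=> fh.
pose e i : cm_free R o (o i) := << 1 *g (existT _ i (idc (o i)) : free_basis o (o i)) >>.
pose a i := projT1 (cid (fh (o i) (e i))).
have aP i : f (o i) (a i) = h (o i) (e i) := projT2 (cid (fh (o i) (e i))).
pose k y : {linear cm_free R o y -> A y} :=
  fglift (fun t : free_basis o y => act A (projT2 t) (a (projT1 t))).
have kU y (t : free_basis o y) : k y << 1 *g t >> = act A (projT2 t) (a (projT1 t)).
  by rewrite [LHS]liftU scale1r.
have kE y z (u : hom y z) m : k y (act (cm_free R o) u m) = act A u (k z m).
  apply: (freeg_linext (f := k y \o act (cm_free R o) u) (g := act A u \o k z)) => t.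
  rewrite -[LHS]/(k y (@free_lin R Gam I o _ _ u << 1 *g t >>)) free_linU kU.
  by rewrite -[RHS]/(act A u (k z << 1 *g t >>)) kU -act_cmp.
exists (CMap kE) => y; apply: (freeg_linext (f := f y \o k y) (g := h y)) => -[i u].
rewrite -[LHS]/(f y (k y << 1 *g _ >>)) kU /= cmapE aP -cmapE.
by congr (h y _); rewrite [LHS]free_linU /free_act /= cmp1l.
Qed.

(** Only the values of h need to lie in the image of f.  This form serves
    surjections and the exact places of a resolution alike. *)
Lemma projective_lift (M A B : cmodule) (f : cmap A B) (h : cmap M B) :
  projective M -> (forall y m, exists a, f y a = h y m) ->
  exists k : cmap M A, forall y m, f y (k y m) = h y m.
Proof.
move=> [I [o /summand_retract[i [r K]]]] fh.
have [y m|k kP] := @free_lift I o A B f (cm_comp h r); first exact: fh.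
by exists (cm_comp k i) => y m; rewrite [LHS]kP /= K.
Qed.

Lemma fg_projectiveW (M : cmodule) : fg_projective M -> projective M.
Proof. by move=> [n [o h]]; exists 'I_n, o. Qed.
End Lifting.

Lemma dep_choice (T : nat -> Type) (I : forall n, T n -> Prop)
    (L : forall n, T n -> T n.+1 -> Prop) (t0 : T 0%N) :
  I 0%N t0 -> (forall n t, I n t -> exists t', I n.+1 t' /\ L n t t') ->
  exists s : forall n, T n, s 0%N = t0 /\ forall n, L n (s n) (s n.+1).
Proof.
move=> I0 IL.
pose step n (t : {t | I n t}) := cid (IL n (projT1 t) (projT2 t)).
pose s := nat_rect (fun n => {t | I n t}) (exist _ t0 I0)
  (fun n t => exist _ (projT1 (step n t)) (projT2 (step n t)).1).
exists (fun n => projT1 (s n)); split => // n.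
exact: (projT2 (step n (s n))).2.
Qed.

Section Comparison.
Context (R : realType) (Gam : category).
Local Notation cmodule := (cmodule R Gam).
Context (M : cmodule).
Implicit Types P Q : resolution M.

(** Cycles of the augmented complex, so that degree 0 needs no special case. *)
Definition acycle P n y : P n y -> Prop :=
  match n return P n y -> Prop with
  | 0 => fun p => res_eps P y p = 0
  | m.+1 => fun p => res_d P m y p = 0
  end.

Lemma acycleP P n y (p : P n y) : acycle p <-> exists q, res_d P n y q = p.
Proof. by case: n p => [|n] p; [exact: res_exact0|exact: res_exactS]. Qed.

(** Degree by degree.  The invariant, that f n preserves augmented cycles, is what
    makes the next lift possible. *)
Lemma comparison P Q : (forall n, projective (P n)) ->
  exists f : forall n, cmap (P n) (Q n),
    (forall y p, res_eps Q y (f 0%N y p) = res_eps P y p) /\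
    forall n y p, res_d Q n y (f n.+1 y p) = f n y (res_d P n y p).
Proof.
move=> projP.
have [y p|f0 f0P] := @projective_lift _ _ _ _ _ (res_eps Q) (res_eps P) (projP 0%N).
  exact: res_surj.
have [|n f If|f [fE fP]] := @dep_choice (fun n => cmap (P n) (Q n))
  (fun n f => forall y p, acycle p -> acycle (f y p))
  (fun n f f' => forall y p, res_d Q n y (f' y p) = f y (res_d P n y p)) f0.
- by move=> y p /= p0; rewrite f0P.
- have [y p|f' f'P] := @projective_lift _ _ _ _ _ (res_d Q n) (cm_comp f (res_d P n)) (projP n.+1).
    by apply/acycleP/If/acycleP; exists p.
  exists f'; split => [y p /= dp|y p]; last exact: f'P.
  by rewrite f'P /= dp raddf0.
by exists f; split => // y p; rewrite fE f0P.
Qed.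

(** Degree by degree, with the invariant d s = f - 1 on augmented cycles. *)
Lemma homotopy P (f : forall n, cmap (P n) (P n)) : (forall n, projective (P n)) ->
  (forall y p, res_eps P y (f 0%N y p) = res_eps P y p) ->
  (forall n y p, res_d P n y (f n.+1 y p) = f n y (res_d P n y p)) ->
  exists s : forall n, cmap (P n) (P n.+1),
    (forall y p, f 0%N y p = p + res_d P 0 y (s 0%N y p)) /\
    forall n y p, f n.+1 y p =
      p + (res_d P n.+1 y (s n.+1 y p) + s n y (res_d P n y p)).
Proof.
move=> projP feps fd.
have [y p|s0 s0P] := @projective_lift _ _ _ _ _ (res_d P 0) (cm_sub (f 0%N) (cm_id (P 0))) (projP 0%N).
  by apply/res_exact0; rewrite /= raddfB /= feps subrr.
have [|n s Is|s [sE sP]] := @dep_choice (fun n => cmap (P n) (P n.+1))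
  (fun n s => forall y p, acycle p -> res_d P n y (s y p) = f n y p - p)
  (fun n s s' => forall y p, res_d P n.+1 y (s' y p) = f n.+1 y p - p - s y (res_d P n y p)) s0.
- by move=> y p _; rewrite s0P.
- have [y p|s' s'P] := @projective_lift _ _ _ _ _ (res_d P n.+1)
    (cm_sub (cm_sub (f n.+1) (cm_id (P n.+1))) (cm_comp s (res_d P n))) (projP n.+1).
    apply/res_exactS; rewrite /= !raddfB /= fd Is ?subrr//.
    by apply/acycleP; exists p.
  exists s'; split => [y p /= dp|y p]; last exact: s'P.
  by rewrite s'P /= dp raddf0 subr0.
exists s; split => [y p|n y p]; first by rewrite sE s0P /= addrC subrK.
by rewrite sP addrNK addrC subrK.
Qed.
End Comparison.

Section HomologyMap.
Context (R : realType) (G : groupType).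
Local Notation A := (vnalg R G)^c.

Lemma spanned_boundary (D : chain_complex A) n z :
  spanned (@boundary A D n) z -> boundary z.
Proof.
elim=> [|a x v [c cx] _ [c' cv]]; first by exists 0; rewrite raddf0.
by exists (a *: c + c'); rewrite linearP /= cx cv.
Qed.

(** The hypotheses say that g f is homotopic to the identity, so f is injective on
    homology. *)
Lemma vndim_homology_le (D D' : chain_complex A)
    (f : forall n, {linear ch D n -> ch D' n}) (g : forall n, {linear ch D' n -> ch D n})
    (s : forall n, {linear ch D n -> ch D n.+1}) :
  (forall n z, bd D' n (f n.+1 z) = f n (bd D n z)) ->
  (forall n z, bd D n (g n.+1 z) = g n (bd D' n z)) ->
  (forall z, g 0%N (f 0%N z) = z + bd D 0 (s 0%N z)) ->
  (forall n z, g n.+1 (f n.+1 z) = z + (bd D n.+1 (s n.+1 z) + s n (bd D n z))) ->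
  forall n, (vndim (homology D n) <= vndim (homology D' n))%E.
Proof.
move=> fd gd gf0 gfS n.
have fc (z : cycle D n) : f n (cycle_val z) \in @cyclep A D' n.
  case: n z => // n [z /= /eqP dz]; apply/eqP.
  by rewrite fd dz raddf0.
pose F z := Cycle (fc z).
have lF : linear F by move=> a u v; apply: cycle_inj; rewrite /= linearP.
pose F' : {linear cycle D n -> cycle D' n} :=
  HB.pack F (GRing.isLinear.Build A (cycle D n) (cycle D' n) _ F lF).
have FX z : boundary z -> boundary (F' z).
  by move=> [c cz]; exists (f n.+1 c); rewrite fd cz.
apply: (vndim_mono (f := quotmap FX)).
move=> q r; have [u ->] := qpi_surj q; have [v ->] := qpi_surj r.
rewrite !quotmap_pi => /qpiP/spannedP; rewrite -raddfB => /spanned_boundary[c cw].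
apply/qpiP/spannedP/spanned_gen.
set w := u - v in cw *.
have gfw : exists c', g n (f n (cycle_val w)) = cycle_val w + bd D n c'.
  case: (n) w {cw} => [|k] w; first by exists (s 0%N (cycle_val w)).
  exists (s k.+1 (cycle_val w)); rewrite gfS.
  by have /eqP -> := cycleP w; rewrite raddf0 addr0.
have [c' c'P] := gfw; exists (g n.+1 c - c'); rewrite raddfB /= gd cw.
by apply/eqP; rewrite subr_eq -c'P.
Qed.
End HomologyMap.

Section ResolutionIndependence.
Context (R : realType) (Gam : category) (M : cmodule R Gam).

(** An inequality is enough, since P and Q can be exchanged. *)
Lemma vndim_homology_resolution (P Q : resolution M) x n :
  (forall n, projective (P n)) -> (forall n, projective (Q n)) ->
  (vndim (homology (vnsplitting_complex x P) n) <=
   vndim (homology (vnsplitting_complex x Q) n))%E.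
Proof.
move=> pP pQ.
have [f [feps fd]] := comparison Q pP.
have [g [geps gd]] := comparison P pQ.
have [|k y p|s [s0 sS]] := @homotopy R Gam M P (fun n => cm_comp (g n) (f n)) pP.
- by move=> y p; rewrite /= geps feps.
- by rewrite /= gd fd.
apply: (@vndim_homology_le R (aut x) (vnsplitting_complex x P) (vnsplitting_complex x Q)
  (fun n => vnsplitting_map x (f n)) (fun n => vnsplitting_map x (g n))
  (fun n => vnsplitting_map x (s n))) => [k z|k z|z|k z].
- rewrite -[LHS]/(vnsplitting_map x (res_d Q k) (vnsplitting_map x (f k.+1) z)).
  rewrite -[RHS]/(vnsplitting_map x (f k) (vnsplitting_map x (res_d P k) z)).
  by rewrite -!vnmap_comp; apply: vnmap_eq => p; exact: fd.
- rewrite -[LHS]/(vnsplitting_map x (res_d P k) (vnsplitting_map x (g k.+1) z)).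
  rewrite -[RHS]/(vnsplitting_map x (g k) (vnsplitting_map x (res_d Q k) z)).
  by rewrite -!vnmap_comp; apply: vnmap_eq => p; exact: gd.
- rewrite -[LHS]/(vnsplitting_map x (g 0%N) (vnsplitting_map x (f 0%N) z)) -vnmap_comp.
  rewrite (vnmapP (f := cm_id (P 0%N)) (g := cm_comp (res_d P 0) (s 0%N)) (s0 x)).
  by rewrite vnmap_id// vnmap_comp.
- rewrite -[LHS]/(vnsplitting_map x (g k.+1) (vnsplitting_map x (f k.+1) z)) -vnmap_comp.
  rewrite (vnmapP (f := cm_id (P k.+1)) (g := cm_add (cm_comp (res_d P k.+1) (s k.+1))
    (cm_comp (s k) (res_d P k))) (sS k x)) vnmap_id//.
  rewrite (vnmapP (f := cm_comp (res_d P k.+1) (s k.+1)) (g := cm_comp (s k) (res_d P k)))//.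
  by rewrite (vnmap_comp (res_d P k.+1) (s k.+1) z) (vnmap_comp (s k) (res_d P k) z).
Qed.
End ResolutionIndependence.

(** * The rank homomorphism on K_0 *)
Section K0Rank.
Context (R : realType) (Gam : category) (rep : isocl Gam -> Gam).
Context (repK : forall c, iso_class (rep c) = c).
Context (Gam_df : directly_finite Gam).
Local Notation fgproj := (fgproj R Gam).
Implicit Types P Q : fgproj.

Definition rk2_at (M : cmodule R Gam) (c : isocl Gam) : R := rdim (vnsplitting (rep c) M).

Lemma vndim_rk2_at P c : vndim (vnsplitting (rep c) P) = (rk2_at P c)%:E.
Proof. by rewrite vndim_rdim//; apply: vnsplitting_is_fgproj => //; exact: fgproj_fg. Qed.

Lemma ex_rkgen P : exists D : {freeg (isocl Gam) / R}, forall c, coeff c D = rk2_at P c.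
Proof.
have [s sP] := vnsplitting_support (fgproj_fg P).
exists (\sum_(c <- undup s) << rk2_at P c *g c >>) => c.
rewrite raddf_sum /=; under eq_bigr do rewrite coeffU.
have [cs|cs] := boolP (c \in undup s).
  rewrite (bigD1_seq c)//= ?undup_uniq// eqxx mulr1 big1 ?addr0// => d /negPf->.
  by rewrite mulr0.
rewrite big_seq big1 => [|d ds].
  by rewrite /rk2_at sP// repK -mem_undup.
by case: eqP ds cs => [->->|]//; rewrite mulr0.
Qed.

Definition rkgen P : {freeg (isocl Gam) / R} := projT1 (cid (ex_rkgen P)).

Lemma rkgenE P c : coeff c (rkgen P) = rk2_at P c.
Proof. exact: (projT2 (cid (ex_rkgen P))). Qed.

Definition rkword (w : k0word R Gam) : {freeg (isocl Gam) / R} :=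
  \sum_(g <- w) (if g.1 then rkgen g.2 else - rkgen g.2).

Lemma rk2_at_iso P Q c : cm_isomorphic P Q -> rk2_at P c = rk2_at Q c.
Proof.
move=> [f /cm_inv[g fg]]; rewrite /rk2_at /rdim; congr fine.
apply/eqP; rewrite eq_le; apply/andP; split.
  apply: (vndim_mono (f := vnsplitting_map (rep c) f)).
  by apply: can_inj; exact: (vnmap_cancel (fg _).1).
apply: (vndim_mono (f := vnsplitting_map (rep c) g)).
by apply: can_inj; exact: (vnmap_cancel (fg _).2).
Qed.

(** P2 and P1 are projective, so the sequence splits by maps s and k, and the
    additive functor F_x takes the splitting to one of N-modules. *)
Lemma rk2_at_exact (P0 P1 P2 : fgproj) c : short_exact P0 P1 P2 ->
  rk2_at P1 c = rk2_at P0 c + rk2_at P2 c.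
Proof.
move=> [f [g ex]].
have [y m|s sP] := @projective_lift R Gam _ _ _ g (cm_id P2) (fg_projectiveW (fgproj_fg P2)).
  by have [_ /(_ m)] := ex y.
have [y m|k kP] := @projective_lift R Gam _ _ _ f (cm_sub (cm_id P1) (cm_comp s g))
    (fg_projectiveW (fgproj_fg P1)).
  by have [_ _ <-] := ex y; rewrite /= raddfB /= sP subrr.
pose x := rep c.
have kf : cancel (f x) (k x).
  move=> m; have [inj _ ker] := ex x; apply: inj; rewrite kP /=.
  have -> : g x (f x m) = 0 by apply/ker; exists m.
  by rewrite raddf0 subr0.
apply: (@rdim_split _ _ _ _ _ (vnsplitting_map x f) (vnsplitting_map x k)
  (vnsplitting_map x s) (vnsplitting_map x g)).
- exact: vnmap_cancel.
- by apply: vnmap_cancel => m; exact: sP.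
- move=> z; rewrite -!vnmap_comp -(vnmapP (h := cm_id P1)) ?vnmap_id// => m /=.
  by rewrite kP /= subrK.
- by apply: vnsplitting_is_fgproj => //; exact: fgproj_fg.
Qed.

Lemma rkword_cat w w' : rkword (w ++ w') = rkword w + rkword w'.
Proof. exact: big_cat. Qed.

Lemma rkword1 P : rkword [:: (true, P)] = rkgen P.
Proof. by rewrite /rkword big_cons big_nil addr0. Qed.

Lemma rkword_rel w w' : k0rel w w' -> rkword w = rkword w'.
Proof.
elim=> {w w'} //.
- by move=> w w' w'' _ -> _ ->.
- by move=> w1 w1' w2 w2' _ e1 _ e2; rewrite !rkword_cat e1 e2.
- by move=> w1 w2; rewrite !rkword_cat addrC.
- by move=> [] P; rewrite /rkword !big_cons !big_nil /= addr0 (subrr, addNr).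
- move=> P Q PQ; rewrite !rkword1; apply/eqP/freeg_eqP => c.
  by rewrite !rkgenE; exact: rk2_at_iso.
- move=> P0 P1 P2 ex; rewrite rkword1 -[X in _ = rkword X]cat1s rkword_cat !rkword1.
  by apply/eqP/freeg_eqP => c; rewrite coeffD !rkgenE; exact: rk2_at_exact.
Qed.

Definition rk2 (a : K0 R Gam) := rkword (k0repr a).

Lemma rk2_class w : rk2 (k0class w) = rkword w.
Proof. exact/rkword_rel/k0rel_repr. Qed.

Lemma rk2D a b : rk2 (k0add a b) = rk2 a + rk2 b.
Proof. by rewrite rk2_class rkword_cat. Qed.

Lemma rk2N a : rk2 (k0opp a) = - rk2 a.
Proof.
apply/eqP; rewrite -addr_eq0 -rk2D k0addN rk2_class.
by rewrite /rkword big_nil.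
Qed.

Lemma rk2_gen P c : coeff c (rk2 (k0gen P)) = rk2_at P c.
Proof. by rewrite rk2_class rkword1 rkgenE. Qed.

Lemma rk2_is_rk2 : is_rk2 rep rk2.
Proof. by split=> [a b|P c]; [exact: rk2D|rewrite rk2_gen vndim_rk2_at]. Qed.

Lemma rk2_altsum (a : nat -> K0 R Gam) n c :
  coeff c (rk2 (k0altsum a n)) = \sum_(i < n) (-1) ^+ i * coeff c (rk2 (a i)).
Proof.
rewrite -(big_mkord xpredT (fun i => (-1) ^+ i * coeff c (rk2 (a i)))) /index_iota subn0.
rewrite /k0altsum; elim: (iota 0 n) => [|i s IH] /=.
  by rewrite big_nil rk2_class /rkword big_nil coeff0.
rewrite big_cons rk2D coeffD IH; congr (_ + _).
by rewrite -signr_odd; case: (odd i); rewrite ?rk2N ?coeffN ?expr1 ?expr0 ?mulN1r ?mul1r.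
Qed.
End K0Rank.

(** * Comparison of the two Euler characteristics *)
Section EulerSum.
Context (R : realType) (G : groupType).
Local Notation A := (vnalg R G)^c.

(** After n steps the alternating sum of the homology dimensions is the alternating
    sum of the dimensions of the modules up to a boundary term in z n, which
    vanishes beyond degree L. *)
Lemma euler_characteristic (D : chain_complex A) L :
  (forall n, is_fgproj (ch D n)) -> (forall n, (L <= n)%N -> rdim (ch D n) = 0) ->
  chi2 D = \sum_(i < L) (-1) ^+ i * rdim (ch D i).
Proof.
move=> fD D0; have [z [z0 zle Hz]] := vndim_homology fD.
have zL n : (L <= n)%N -> z n = 0.
  by move=> /D0 dn; have := zle n; rewrite dn -eq_le => /eqP.
have part n : series (fun p => (-1) ^+ p * fine (vndim (homology D p))) n =
    \sum_(i < n.+1) (-1) ^+ i * rdim (ch D i) - (-1) ^+ n * z n.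
  rewrite /series /=; elim: n => [|n IH].
    by rewrite big_geq// big_ord1 expr0 !mul1r z0 subrr.
  rewrite big_nat_recr//= IH Hz /= [in RHS]big_ord_recr /= exprS.
  by ring.
apply: lim_near_cst; first exact: Rhausdorff.
exists L => // n /= Ln; rewrite part zL// mulr0 subr0.
rewrite -!(big_mkord xpredT (fun i => (-1) ^+ i * rdim (ch D i))).
rewrite (@big_cat_nat _ _ _ L)//= ?(leqW Ln)//.
rewrite [X in _ + X](_ : _ = 0) ?addr0// big_nat_cond big1// => i /andP[/andP[Li _] _].
by rewrite D0 ?mulr0.
Qed.

Lemma eq_chi2 (D D' : chain_complex A) :
  (forall n, vndim (homology D n) = vndim (homology D' n)) -> chi2 D = chi2 D'.
Proof.
move=> e; rewrite /chi2; congr (lim (series _ @ \oo)).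
by apply/funext => p; rewrite e.
Qed.

Lemma h2_finite (D : chain_complex A) L :
  (forall n, is_fgproj (ch D n)) -> (forall n, (L <= n)%N -> rdim (ch D n) = 0) ->
  exists r : R, [/\ h2 D = r%:E, 0 <= r &
    (forall n, rdim (ch D n) = 0) -> r = 0].
Proof.
move=> fD D0; have [z [z0 zle Hz]] := vndim_homology fD.
have zL n : rdim (ch D n) = 0 -> z n = 0.
  by move=> dn; have := zle n; rewrite dn -eq_le => /eqP.
pose v p := z p - rdim (ch D p.+1) + z p.+1.
have v0 n : (L <= n)%N -> v n = 0.
  by move=> Ln; rewrite /v !zL ?D0 ?leqW// subr0 addr0.
exists (\sum_(0 <= p < L) v p); split.
- apply: lim_near_cst; first exact: ereal_hausdorff.
  exists L => // n /= Ln; rewrite (@big_cat_nat _ _ _ L)//=.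
  rewrite [X in (_ + X)%E](_ : _ = 0%E).
    by rewrite adde0 -sumEFin; apply: eq_bigr => p _; rewrite Hz.
  rewrite big_nat_cond big1// => i /andP[/andP[Li _] _].
  by rewrite Hz -/(v i) v0.
- by apply: sumr_ge0 => p _; rewrite -lee_fin -Hz vndim_ge0.
- by move=> d0; apply: big1 => p _; rewrite /v !zL ?d0// subr0 addr0.
Qed.
End EulerSum.

Section Main.
Context (R : realType) (Gam : category) (rep : isocl Gam -> Gam).
Context (repK : forall c, iso_class (rep c) = c).
Context (Gam_df : directly_finite Gam).

Lemma fgres_projective (P : fg_resolution R Gam) n : projective (fgres P n).
Proof. exact/fg_projectiveW/fgres_fg. Qed.

Lemma fgres_is_fgproj (P : fg_resolution R Gam) x n :
  is_fgproj (ch (vnsplitting_complex x P) n).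
Proof. by apply: vnsplitting_is_fgproj => //; exact: fgres_fg. Qed.

Lemma fgres_dim0 (P : fg_resolution R Gam) x n : (fgres_len P <= n)%N ->
  rdim (ch (vnsplitting_complex x P) n) = 0.
Proof.
move=> Pn; apply: rdim0; apply: vngen_zero => m.
by rewrite (fgres_zero Pn m) vngen0.
Qed.

(** Each h2 is finite as the complex is, and it vanishes outside the classes that
    support one of the finitely many nonzero modules. *)
Lemma fgres_L2 (P : fg_resolution R Gam) : L2_resolution rep P.
Proof.
split; first exact: fgres_projective.
have /choice[r rP] c := h2_finite (fgres_is_fgproj P (rep c)) (@fgres_dim0 P (rep c)).
have /choice[s sP] n : exists s : seq (isocl Gam), forall x, iso_class x \notin s ->
    rdim (vnsplitting x (fgres P n)) = 0 by apply: vnsplitting_support; exact: fgres_fg.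
pose S := flatten [seq s i | i <- iota 0 (fgres_len P)].
have rS c : c \notin S -> r c = 0.
  move=> cS; have [_ _] := rP c; apply=> n.
  have [/fgres_dim0//|nL] := leqP (fgres_len P) n.
  apply: sP; rewrite repK; apply: contra cS => cs.
  by apply/flatten_mapP; exists n; rewrite // mem_iota.
rewrite (_ : esum _ _ = \esum_(c in [set` S]) (r c)%:E)%E; last first.
  rewrite [RHS]esum_mkcond; apply: eq_esum => c _; have [-> _ _] := rP c.
  by case: ifPn => //; rewrite mem_setE => /rS ->.
have finS : finite_set [set` S] by exact: finite_seq.
by rewrite esum_fset ?fsumEFin ?ltry// => c _; have [_ r0 _] := rP c; rewrite lee_fin.
Qed.

Lemma chi2_resolution (P : fg_resolution R Gam) (Q : resolution (cm_const R Gam)) x :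
  projective_resolution Q ->
  chi2 (vnsplitting_complex x Q) =
  \sum_(i < fgres_len P) (-1) ^+ i * rdim (vnsplitting x (fgres P i)).
Proof.
move=> pQ; rewrite -(euler_characteristic (fgres_is_fgproj P x) (@fgres_dim0 P x)).
have pP := fgres_projective P.
apply: eq_chi2 => n; apply/eqP; rewrite eq_le; apply/andP; split.
  exact: (vndim_homology_resolution x n pQ pP).
exact: (vndim_homology_resolution x n pP pQ).
Qed.
End Main.

Theorem theorem5p22 (R : realType) (Gam : category)
    (rep : isocl Gam -> Gam) (repK : forall c, iso_class (rep c) = c)
    (Gam_df : directly_finite Gam) (Gam_FP : type_FP R Gam) :
  type_L2 R rep /\
  exists rk : K0 R Gam -> {freeg (isocl Gam) / R},
    is_rk2 rep rk /\
    forall (o : K0 R Gam) (chi : isocl Gam -> R),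
      is_finiteness_obstruction o -> is_chif2 rep chi ->
      forall c : isocl Gam, coeff c (rk o) = chi c.
Proof.
split; first by have [P] := Gam_FP; exists P; exact: fgres_L2.
exists (@rk2 R Gam rep repK); split; first exact: (rk2_is_rk2 R repK Gam_df).
move=> _ _ [P ->] [Q [pQ _] ->] c.
rewrite (chi2_resolution Gam_df P)// rk2_altsum//.
by apply: eq_bigr => i _; rewrite rk2_gen.
Qed.
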